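(* There exists an absolute constant $c>0$ such that the following holds. Let $p\geq 3$ be a prime and let $f\colon \mathbb{Z}_p\to\mathbb{C}$ be a function with nonempty support $S:=\{x\in\mathbb{Z}_p: f(x)\neq 0\}$ such that $|f(x)|\geq 1$ for all $x\in S$. Set $M:=\max_{x\in\mathbb{Z}_p}|f(x)|$. Then $$\|\hat f\|_1\geq M$$ and $$\|\hat f\|_1\geq c\,\min\left(\log|S|,\ \left(\frac{\log p}{(\log\log p)(\log|S|)}\right)^{1/2}\right),$$ where for $|S|=1$ the second argument of the minimum is interpreted as $+\infty$ (so the minimum is $0$). In particular, $\|\hat f\|_1\geq c\log|S|$ whenever $|S|\leq \exp\left((\log p/\log\log p)^{1/3}\right)$.
   Context: $\mathbb{Z}_p=\mathbb{Z}/p\mathbb{Z}$, and $\log$ is the natural logarithm. For $f\colon\mathbb{Z}_p\to\mathbb{C}$ the Fourier transform is $\hat f(\xi)=p^{-1}\sum_{x\in\mathbb{Z}_p}f(x)e^{-2\pi i\xi x/p}$ for $\xi\in\mathbb{Z}_p$, and the Wiener norm of $f$ is $\|\hat f\|_1=\sum_{\xi\in\mathbb{Z}_p}|\hat f(\xi)|$. *)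

(* Defs.v *)
From HB Require Import structures.
From mathcomp Require Export all_boot all_order all_algebra.
From mathcomp Require Export reals ereal sequences exp trigo.
From mathcomp Require Export complex.

Set Implicit Arguments.
Unset Strict Implicit.
Unset Printing Implicit Defensive.

Import Order.TTheory GRing.Theory Num.Theory.
Export ComplexField.Normc.

Local Open Scope ring_scope.
Local Open Scope complex_scope.

Section Wiener.
Context {R : realType}.

(* e^{i t}, by Euler's formula. *)
Definition expi (t : R) : R[i] := cos t +i* sin t.

Context {p : nat}.
Implicit Type f : 'Z_p -> R[i].

(* The product of [xi] and [x] is that of their representatives in nat; as
   expi is 2 pi-periodic, the choice of representatives does not matter.
   'Z_p is Z/pZ only for 1 < p. *)
Definition fourier f (xi : 'Z_p) : R[i] :=
  (p%:R)^-1 *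
  \sum_(x : 'Z_p) f x * expi (- (2 * pi * (xi * x)%N%:R / p%:R)).

(* Moduli are taken with [normc], which is R-valued, whereas the
   canonical norm of R[i] takes its values in R[i]. *)
Definition wiener_norm f : R := \sum_(xi : 'Z_p) normc (fourier f xi).

Definition supp f : {set 'Z_p} := [set x | f x != 0]%SET.

(* Moduli are nonnegative, so the default value 0 is harmless. *)
Definition max_modulus f : R := \big[Num.max/0]_(x : 'Z_p) normc (f x).

End Wiener.

(* (log p / ((log log p) (log s)))^{1/2}, equal to +oo for s = 1, where the
   real division would return 0. *)
Definition sparse_bound (R : realType) (p s : nat) : \bar R :=
  if s == 1%N then +oo%E
  else ((ln p%:R / (ln (ln p%:R) * ln s%:R)) `^ (1 / 2))%:E.

(* Main.v *)
Require Import Defs.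
From mathcomp Require Import boolp.
From mathcomp Require Import ring lra zify.

(** Write [K] for the Wiener norm of [f], [S] for its support and [N = #|S|].
    That [K >= max |f|] is Fourier inversion. For the main inequality, the
    support is shown to be either contained in the signed sums of few elements,
    in which case the problem can be moved to the integers, or so rich that [K]
    must be large.

    Dimension. Let [s] be a maximal dissociated subset of [S], meaning that no
    nontrivial combination with coefficients in [{-1, 0, 1}] vanishes, and let
    [d] be its size; then every element of [S] is such a combination of [s].
    The characters of [s] behave like independent random variables
    ([sum_expR_dissociated], through Riesz products), so their sums have
    subgaussian exponential moments. Pairing [f] with a sum of these
    characters carrying the conjugate phases of [f] gives at least [d], while
    Jensen's inequality and Cauchy-Schwarz bound the pairing; as a result
    [d <= 64 K^2 ln (2 N)] ([dissociated_size_le]).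

    Rectification. If [(4 d)^d < p], Dirichlet's approximation theorem gives a
    dilation that makes all elements of [s] smaller than about [p / (4 d)],
    hence moves [S] into an interval of length less than [p / 2]. Dilations
    preserve [K], and for frequencies in such an interval [K] is comparable
    with the [L^1] norm over the circle of a sum of [N] exponentials with
    coefficients of modulus at least [1] ([avg_transfer]). Littlewood's
    inequality bounds the latter below by a multiple of [ln N]
    ([wiener_ge_rectified]). If on the contrary [(4 d)^d >= p], then [d] is at
    least of order [ln p / ln (ln p)], and the dimension bound gives
    [K^2 ln N >= c ln p / ln (ln p)].

    Littlewood's inequality is proved by the duality argument of McGehee, Pigno
    and Smith: one builds a bounded function whose Fourier coefficients on the
    [j]-th block of [4^j] frequencies are close to [4^-j] times the phases of
    the sum. The blocks are added one at a time, and the partial sum is first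
    multiplied by a function close to [exp (- h)], where [h] is analytic and
    [Re h] is about [|f_j|] up to a constant; this keeps the sum bounded, and
    analyticity prevents the earlier blocks from disturbing the coefficients of
    the later ones. All functions here are kept polynomial ([damping_factor]):
    [|f_j|] is approximated by a polynomial in [|f_j|^2], and the exponential by
    a power. Integrals over the circle then become averages over sufficiently
    many roots of unity, and everything reduces to finite sums ([avg_coef]). *)

Set Implicit Arguments.
Unset Strict Implicit.
Unset Printing Implicit Defensive.

Import Order.TTheory GRing.Theory Num.Theory.

Local Open Scope ring_scope.
Local Open Scope complex_scope.

(** * Moduli of complex numbers and averages over roots of unity *)

Section ComplexModulus.
Context {R : realType}.
Implicit Types x y : R[i].

Lemma normc_ge0 x : 0 <= normc x.
Proof. by case: x => a b; exact: sqrtr_ge0. Qed.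

Lemma sqr_normcE x : normc x ^+ 2 = complex.Re x ^+ 2 + complex.Im x ^+ 2.
Proof. by case: x => a b; rewrite /= sqr_sqrtr ?addr_ge0 ?sqr_ge0. Qed.

Lemma mulc_conj x : x * x^*%C = (normc x ^+ 2)%:C.
Proof.
rewrite sqr_normcE; case: x => a b /=.
by apply/eqP; rewrite eq_complex /=; apply/andP; split; apply/eqP; ring.
Qed.

Lemma conj_mul_conj x y : (x * y^*%C)^*%C = x^*%C * y.
Proof. by rewrite rmorphM /= conjcK. Qed.

Lemma normc_conj x : normc (x^*%C) = normc x.
Proof. by case: x => a b /=; rewrite sqrrN. Qed.

Lemma normc_real (a : R) : normc a%:C = `|a|.
Proof. by rewrite /= expr0n addr0 sqrtr_sqr. Qed.

Lemma normc_nat n : normc (n%:R : R[i]) = n%:R.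
Proof. by rewrite -(rmorph_nat (@real_complex R)) normc_real ger0_norm. Qed.

Lemma normcX x n : normc (x ^+ n) = normc x ^+ n.
Proof.
elim: n => [|n IH]; first by rewrite !expr0 normc1.
by rewrite !exprS normcM IH.
Qed.

Lemma normc_eq0 x : (normc x == 0) = (x == 0).
Proof. by apply/eqP/eqP => [/eq0_normc|->] //; rewrite normc0. Qed.

Lemma normc_sum I (r : seq I) (P : pred I) (F : I -> R[i]) :
  normc (\sum_(i <- r | P i) F i) <= \sum_(i <- r | P i) normc (F i).
Proof.
elim/big_rec2: _ => [|i y1 y2 _ le12]; first by rewrite normc0.
by apply: le_trans (le_normcD _ _) _; rewrite lerD2l.
Qed.

Lemma ReD x y : complex.Re (x + y) = complex.Re x + complex.Re y.
Proof. by case: x; case: y. Qed.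

Lemma ReB x y : complex.Re (x - y) = complex.Re x - complex.Re y.
Proof. by case: x; case: y. Qed.

Lemma Re_sum I (r : seq I) (P : pred I) (F : I -> R[i]) :
  complex.Re (\sum_(i <- r | P i) F i) = \sum_(i <- r | P i) complex.Re (F i).
Proof. exact: (big_morph (@complex.Re R) ReD (erefl _)). Qed.

Lemma Re_realM (a : R) x : complex.Re (a%:C * x) = a * complex.Re x.
Proof. by case: x => b d /=; ring. Qed.

Lemma Re_conjc x : complex.Re (x^*%C) = complex.Re x.
Proof. by case: x. Qed.

Lemma abs_Re_le x : `|complex.Re x| <= normc x.
Proof.
rewrite -(ler_pXn2r (n := 2)) ?nnegrE ?normc_ge0 //.
by rewrite sqr_normcE real_normK ?num_real // lerDl sqr_ge0.
Qed.

Lemma Re_le x : complex.Re x <= normc x.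
Proof. exact: le_trans (ler_norm _) (abs_Re_le x). Qed.

Lemma normc_le_ReIm x : normc x <= `|complex.Re x| + `|complex.Im x|.
Proof.
rewrite -(ler_pXn2r (n := 2)) ?nnegrE ?normc_ge0 ?addr_ge0 //.
have := mulr_ge0 (normr_ge0 (complex.Re x)) (normr_ge0 (complex.Im x)).
rewrite sqr_normcE sqrrD !real_normK ?num_real //; lra.
Qed.

End ComplexModulus.

Section RootsOfUnity.
Context {R : realType}.
Implicit Types P k n : nat.

Lemma expiD (s t : R) : expi (s + t) = expi s * expi t.
Proof.
rewrite /expi sinD cosD; apply/eqP; rewrite eq_complex /=.
by apply/andP; split; apply/eqP; ring.
Qed.

Lemma expi0 : expi 0 = 1 :> R[i].
Proof. by rewrite /expi sin0 cos0. Qed.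

Lemma expiN (t : R) : expi (- t) = (expi t)^*%C.
Proof. by rewrite /expi sinN cosN. Qed.

Lemma normc_expi (t : R) : normc (expi t) = 1.
Proof. by rewrite /= cos2Dsin2 sqrtr1. Qed.

Lemma expi2pi n : expi (2 * pi * n%:R) = 1 :> R[i].
Proof.
elim: n => [|n IH]; first by rewrite mulr0 expi0.
rewrite -[n.+1%:R]natr1 mulrDr expiD IH mul1r mulr1 mulr_natl.
by rewrite /expi sin2pi cos2pi.
Qed.

Definition unity P k : R[i] := expi (2 * pi * k%:R / P%:R).

Lemma unityD P k n : unity P (k + n) = unity P k * unity P n.
Proof. by rewrite /unity natrD mulrDr mulrDl expiD. Qed.

Lemma unity0 P : unity P 0 = 1.
Proof. by rewrite /unity mulr0 mul0r expi0. Qed.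

Lemma unityM P k n : unity P (k * n) = unity P k ^+ n.
Proof.
elim: n => [|n IH]; first by rewrite muln0 unity0.
by rewrite mulnS unityD IH exprS.
Qed.

Lemma unityMP P k : (0 < P)%N -> unity P (k * P) = 1.
Proof.
move=> P0; rewrite /unity natrM mulrA mulfK ?expi2pi //.
by rewrite pnatr_eq0 -lt0n.
Qed.

Lemma unity_modn P k : (0 < P)%N -> unity P (k %% P) = unity P k.
Proof. by move=> P0; rewrite {2}(divn_eq k P) unityD unityMP // mul1r. Qed.

Lemma normc_unity P k : normc (unity P k) = 1.
Proof. exact: normc_expi. Qed.

Lemma conj_mul_circle (z : R[i]) : normc z = 1 -> z * z^*%C = 1.
Proof. by move=> z1; rewrite mulc_conj z1 expr1n. Qed.

Lemma conj_unity_exp P k n : (0 < P)%N -> (n <= P)%N ->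
  (unity P k)^*%C ^+ n = unity P k ^+ (P - n).
Proof.
move=> P0 nP; have zn : (unity P k) ^+ n * ((unity P k)^*%C) ^+ n = 1.
  by rewrite -exprMn conj_mul_circle ?normc_unity // expr1n.
have zP : unity P k ^+ P = 1 by rewrite -unityM unityMP.
have zPn : unity P k ^+ P = unity P k ^+ (P - n) * unity P k ^+ n.
  by rewrite -exprD subnK.
by rewrite -[LHS]mul1r -zP zPn -mulrA zn mulr1.
Qed.

(** If [0 < k < P], the half-angle [s] is in [(0, pi)], so that the real part
    [1 - 2 sin^2 s] of the root is not [1]. *)
Lemma unity_neq1 P k : (0 < k < P)%N -> unity P k != 1.
Proof.
case/andP=> k0 kP; have P0 : (0 : R) < P%:R by rewrite ltr0n; lia.
set s : R := pi * k%:R / P%:R.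
have s0 : 0 < s by rewrite divr_gt0 // mulr_gt0 ?pi_gt0 // ltr0n.
have spi : s < pi by rewrite ltr_pdivrMr // ltr_pM2l ?pi_gt0 // ltr_nat.
have ss : 0 < sin s by rewrite sin_gt0_pi // s0.
apply/eqP => /(congr1 (@complex.Re R)) /=.
rewrite (_ : 2 * pi * k%:R / P%:R = s *+ 2); last by rewrite /s; ring.
rewrite cos_mulr2n cos2sin2 => e.
have : 0 < sin s ^+ 2 by rewrite exprn_gt0.
move: e; lra.
Qed.

Lemma sum_unity P k : (0 < P)%N ->
  \sum_(t < P) unity P (t * k) = if (P %| k)%N then P%:R else 0.
Proof.
move=> P0; case: ifP => [/dvdnP [m ->]|ndiv].
  rewrite (eq_bigr (fun=> 1)) ?sumr_const ?card_ord // => t _.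
  by rewrite mulnA unityMP.
under eq_bigr => t _ do rewrite mulnC unityM.
have z1 : unity P k != 1.
  rewrite -unity_modn //; apply: unity_neq1.
  by rewrite lt0n -/(dvdn P k) ndiv ltn_mod P0.
have := subrX1 (unity P k) P.
rewrite -unityM unityMP // subrr => /esym/eqP.
by rewrite mulf_eq0 subr_eq0 (negbTE z1) => /eqP.
Qed.

(** Stands for the normalised integral over the unit circle, with which it
    agrees on the product of a polynomial and a conjugate polynomial, both of
    size at most [P]. *)
Definition avg (V : fieldType) P (g : R[i] -> V) : V :=
  P%:R^-1 * \sum_(t < P) g (unity P t).

Lemma avg_ext (V : fieldType) P (g g' : R[i] -> V) :
  (forall t, g (unity P t) = g' (unity P t)) -> avg P g = avg P g'.
Proof. by move=> e; congr (_ * _); apply: eq_bigr => t _; exact: e. Qed.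

Lemma eq_avg (V : fieldType) P (g g' : R[i] -> V) :
  (forall z, g z = g' z) -> avg P g = avg P g'.
Proof. by move=> e; apply: avg_ext. Qed.

Lemma avgD (V : fieldType) P (g g' : R[i] -> V) :
  avg P (fun z => g z + g' z) = avg P g + avg P g'.
Proof. by rewrite /avg big_split mulrDr. Qed.

Lemma avg_sum (V : fieldType) P I (r : seq I) (Q : pred I) (g : I -> R[i] -> V) :
  avg P (fun z => \sum_(i <- r | Q i) g i z) = \sum_(i <- r | Q i) avg P (g i).
Proof. by rewrite /avg exchange_big /= mulr_sumr. Qed.

Lemma avgZ (V : fieldType) P (a : V) (g : R[i] -> V) :
  avg P (fun z => a * g z) = a * avg P g.
Proof. by rewrite /avg -mulr_sumr mulrCA. Qed.

Lemma avg_const P (a : R) : (0 < P)%N -> avg P (fun=> a) = a.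
Proof.
move=> P0; rewrite /avg sumr_const card_ord -[a *+ P]mulr_natl mulKf //.
by rewrite pnatr_eq0 -lt0n.
Qed.

Lemma le_avg P (g g' : R[i] -> R) :
  (forall t, g (unity P t) <= g' (unity P t)) -> avg P g <= avg P g'.
Proof.
by move=> le; rewrite ler_wpM2l ?invr_ge0 ?ler0n // ler_sum.
Qed.

Lemma avg_ge0 P (g : R[i] -> R) :
  (forall t, 0 <= g (unity P t)) -> 0 <= avg P g.
Proof. by move=> le; rewrite mulr_ge0 ?invr_ge0 ?ler0n // sumr_ge0. Qed.

Lemma Re_avg P (g : R[i] -> R[i]) :
  complex.Re (avg P g) = avg P (fun z => complex.Re (g z)).
Proof.
rewrite /avg -(rmorph_nat (@real_complex R)) -(fmorphV (@real_complex R)).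
by rewrite Re_realM Re_sum.
Qed.

Lemma avg_real P (g : R[i] -> R) :
  avg P (fun z => (g z)%:C) = (avg P g)%:C.
Proof.
rewrite /avg rmorphM fmorphV rmorph_nat; congr (_ * _).
by rewrite rmorph_sum.
Qed.

Lemma normc_avg P (g : R[i] -> R[i]) :
  normc (avg P g) <= avg P (fun z => normc (g z)).
Proof.
rewrite normcM normcV normc_nat ler_wpM2l ?invr_ge0 ?ler0n //.
exact: normc_sum.
Qed.

Lemma avg_char P n m : (n < P)%N -> (m < P)%N ->
  avg P (fun z => z ^+ n * (z^*%C) ^+ m) = (n == m)%:R.
Proof.
move=> nP mP; have P0 : (0 < P)%N by lia.
rewrite /avg (eq_bigr (fun t : 'I_P => unity P (t * (n + (P - m))))); last first.
  by move=> t _; rewrite conj_unity_exp ?(ltnW mP) // -exprD -unityM.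
rewrite sum_unity //; have -> : (P %| n + (P - m))%N = (n == m).
  apply/idP/eqP => [/dvdnP [k e]|->]; last by rewrite subnKC ?dvdnn // ltnW.
  by have : k = 1%N; nia.
by case: eqP => _; rewrite ?mulr0 // mulVf // pnatr_eq0 -lt0n.
Qed.

Lemma avg_coef P (q : {poly R[i]}) n : (size q <= P)%N -> (n < P)%N ->
  avg P (fun z => q.[z] * (z^*%C) ^+ n) = q`_n.
Proof.
move=> qP nP.
under eq_avg => z do rewrite (horner_coef_wide _ qP) mulr_suml.
rewrite avg_sum (bigD1 (Ordinal nP)) //= big1 ?addr0.
  under eq_avg => z do rewrite -mulrA.
  by rewrite avgZ avg_char // eqxx mulr1.
move=> i ne; under eq_avg => z do rewrite -mulrA.
by rewrite avgZ avg_char // (_ : (_ == n) = false) ?mulr0 //; exact: negbTE ne.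
Qed.

Lemma avg_inner P (q r : {poly R[i]}) : (size q <= P)%N -> (size r <= P)%N ->
  avg P (fun z => q.[z] * r.[z]^*%C) = \sum_(n < P) q`_n * (r`_n)^*%C.
Proof.
move=> qP rP.
rewrite -(avg_ext (g := fun z => \sum_(n < P) (r`_n)^*%C * (q.[z] * (z^*%C) ^+ n))).
  by rewrite avg_sum; apply: eq_bigr => n _; rewrite avgZ avg_coef // mulrC.
move=> t; rewrite (horner_coef_wide _ rP) rmorph_sum mulr_sumr /=.
by apply: eq_bigr => n _; rewrite rmorphM rmorphXn /= mulrCA.
Qed.

Lemma parseval P (q : {poly R[i]}) : (size q <= P)%N ->
  avg P (fun z => normc q.[z] ^+ 2) = \sum_(n < P) normc q`_n ^+ 2.
Proof.
move=> qP; apply: (@complexI R); rewrite -avg_real rmorph_sum /=.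
under eq_bigr => n _ do rewrite -mulc_conj.
by rewrite -avg_inner //; apply: avg_ext => t; rewrite mulc_conj.
Qed.

End RootsOfUnity.

(** * Sampling a polynomial at roots of unity *)

Section Sampling.
Context {R : realType}.

(** The Dirichlet kernel reproduces low-degree polynomials from their values at
    the [p]-th roots of unity, at any point [w], even off these roots. *)
Lemma dirichlet_reproducing p n (q : {poly R[i]}) (w : R[i]) :
  (size q <= n)%N -> (n <= p)%N ->
  avg p (fun z => q.[z] * \sum_(j < n) (w * z^*%C) ^+ j) = q.[w].
Proof.
move=> qn np.
under eq_avg => z do rewrite mulr_sumr.
rewrite avg_sum (horner_coef_wide _ qn); apply: eq_bigr => j _.
under eq_avg => z do rewrite exprMn mulrCA.
rewrite avgZ avg_coef ?(leq_trans qn) // 1?mulrC //.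
exact: leq_trans (ltn_ord j) np.
Qed.

Lemma avg_sqr_dirichlet P n (u : R[i]) : normc u = 1 -> (n <= P)%N ->
  avg P (fun w => normc (\sum_(j < n) (w * u) ^+ j) ^+ 2) = n%:R.
Proof.
move=> u1 nP; rewrite -(avg_ext (g := fun w => normc (\poly_(j < n) u ^+ j).[w] ^+ 2)).
  rewrite parseval ?(leq_trans (size_poly _ _)) //.
  under eq_bigr => i _ do rewrite coef_poly (fun_if (@normc R)) normcX u1 normc0
    expr1n (fun_if (fun x => x ^+ 2)) expr1n expr0n.
  rewrite -big_mkcond /= -(big_ord_widen _ (fun=> 1)) //.
  by rewrite sumr_const card_ord.
move=> t; rewrite horner_poly; congr (normc _ ^+ 2).
by apply: eq_bigr => j _; rewrite exprMn mulrC.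
Qed.

(** A Marcinkiewicz-Zygmund inequality: for a polynomial whose degree is less
    than [p / 2], the average of the modulus over [p]-th roots of unity controls
    the average over any other such grid. The reproducing kernel is of de la Vallee
    Poussin type, a normalised product of two Dirichlet kernels of lengths
    [M + 1] and [2 M + 1], so that its mean modulus is bounded by the mean
    squares of the factors. *)
Lemma avg_transfer p P M (q : {poly R[i]}) :
  (size q <= M.+1)%N -> (2 * M < p)%N -> (2 * M < P)%N ->
  avg P (fun w => normc q.[w]) <= 3 / 2 * avg p (fun z => normc q.[z]).
Proof.
move=> qM Mp MP.
pose DI (v : R[i]) := \sum_(j < M.+1) v ^+ j.
pose DJ (v : R[i]) := \sum_(j < (2 * M).+1) v ^+ j.
have step w : normc w = 1 -> M.+1%:R * normc q.[w] <=
    avg p (fun z => 1 / 2 * normc q.[z] *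
      (normc (DI (w * z^*%C)) ^+ 2 + normc (DJ (w * z^*%C)) ^+ 2)).
  move=> w1.
  (* Averaging the reproducing formulas for [q * 'X^i] over [i <= M] yields the
     product kernel. *)
  have rep (i : 'I_M.+1) :
      q.[w] = avg p (fun z => q.[z] * ((z * w^*%C) ^+ i * DJ (w * z^*%C))).
    have := @dirichlet_reproducing p (2 * M).+1 (q * 'X^i) w.
    have -> : (size (q * 'X^i)%R <= (2 * M).+1)%N.
      by rewrite (leq_trans (size_polyMleq _ _)) // size_polyXn; have := ltn_ord i; lia.
    move=> /(_ isT Mp) e.
    have {1}-> : q.[w] = (w^*%C) ^+ i * (q * 'X^i).[w].
      rewrite hornerM hornerXn mulrCA -exprMn mulrC [_^*%C * _]mulrC.
      by rewrite conj_mul_circle // expr1n mul1r.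
    rewrite -e -avgZ; apply: eq_avg => z.
    by rewrite hornerM hornerXn exprMn /DJ; ring.
  have sumrep : M.+1%:R * q.[w] = avg p (fun z => q.[z] * (DI (z * w^*%C) * DJ (w * z^*%C))).
    rewrite mulr_natl -{1}(card_ord M.+1) -sumr_const.
    under eq_bigr => i _ do rewrite (rep i).
    rewrite -avg_sum; apply: eq_avg => z.
    by rewrite -mulr_sumr -mulr_suml.
  rewrite -(normc_nat (R := R)) -normcM sumrep.
  apply: le_trans (normc_avg _ _) _; apply: le_avg => t; move: (unity p t) => {t}z.
  have -> : DI (z * w^*%C) = (DI (w * z^*%C))^*%C.
    rewrite /DI rmorph_sum; apply: eq_bigr => i _ /=.
    by rewrite rmorphXn /= rmorphM /= conjcK mulrC.
  rewrite !normcM normc_conj.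
  set a := normc _; set b := normc _; set c := normc _.
  rewrite [1 / 2 * a]mulrC -[a * _ * _]mulrA ler_wpM2l ?normc_ge0 //.
  have := sqr_ge0 (b - c); rewrite sqrrB; lra.
have M0 : 0 < M.+1%:R :> R by rewrite ltr0n.
rewrite -(ler_pM2l M0) -avgZ.
apply: le_trans (le_avg (g' := fun w => avg p (fun z => 1 / 2 * normc q.[z] *
      (normc (DI (w * z^*%C)) ^+ 2 + normc (DJ (w * z^*%C)) ^+ 2))) _) _.
  by move=> t; apply: step; exact: normc_unity.
have -> : avg P (fun w => avg p (fun z => 1 / 2 * normc q.[z] *
      (normc (DI (w * z^*%C)) ^+ 2 + normc (DJ (w * z^*%C)) ^+ 2))) =
  avg p (fun z => (M.+1%:R + (2 * M).+1%:R) / 2 * normc q.[z]).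
  rewrite {1}/avg; under eq_bigr => t _ do rewrite /avg.
  rewrite -mulr_sumr exchange_big /= mulrCA /avg; congr (_ * _).
  rewrite mulr_sumr; apply: eq_bigr => t _; rewrite -mulr_sumr mulrCA.
  set z := unity p t; have zc : normc z^*%C = 1 by rewrite normc_conj normc_unity.
  have e1 := @avg_sqr_dirichlet P M.+1 _ zc; have e2 := @avg_sqr_dirichlet P (2 * M).+1 _ zc.
  have := avgD P (fun w => normc (DI (w * z^*%C)) ^+ 2) (fun w => normc (DJ (w * z^*%C)) ^+ 2).
  rewrite /DI /DJ e1 ?e2 //; last by lia.
  by rewrite /avg => ->; field.
rewrite avgZ [X in _ <= X]mulrA ler_wpM2r //; first by apply: avg_ge0 => t; exact: normc_ge0.
rewrite -[(2 * M).+1%:R]natr1 -[M.+1%:R]natr1 natrM.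
have : 0 <= M%:R :> R by rewrite ler0n.
lra.
Qed.
End Sampling.

(** * Analytic damping factors *)

Section OneSided.
Context {R : realType}.
Implicit Types (f h q : {poly R[i]}) (z : R[i]) (A B : R[i] -> R).

(** The classical iteration for the square root: every iterate is a polynomial
    in [t], which is how [|f|] is reached from the polynomial [|f|^2]. *)
Fixpoint sqrt_iter (k : nat) (t : R) : R :=
  if k is k'.+1 then let s := sqrt_iter k' t in s + (t - s ^+ 2) / 2 else 0.

(** The error is multiplied by [1 - (a + s) / 2] at each step, which is at most
    [1 - err / 2]; this gives the decay [2 / (k + 2)]. *)
Lemma sqrt_iter_bounds k (a : R) : 0 <= a <= 1 ->
  0 <= sqrt_iter k (a ^+ 2) <= a /\ a - sqrt_iter k (a ^+ 2) <= 2 / (k + 2)%:R.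
Proof.
case/andP=> a0 a1; elim: k => [|k [/andP[s0 sa] err]] /=.
  by rewrite lexx a0 subr0 divff ?pnatr_eq0.
set s := sqrt_iter k _ in s0 sa err *.
have e' : a - (s + (a ^+ 2 - s ^+ 2) / 2) = (a - s) * (1 - (a + s) / 2) by field.
have le2 : 0 <= a - (s + (a ^+ 2 - s ^+ 2) / 2).
  by rewrite e' mulr_ge0 //; lra.
have s2 : s ^+ 2 <= a ^+ 2 by rewrite ler_pXn2r // nnegrE.
split; first by apply/andP; split; lra.
have K0 : (0 : R) < (k + 2)%:R by rewrite ltr0n; lia.
have -> : (k.+1 + 2)%:R = (k + 2)%:R + 1 :> R by rewrite natr1.
set K := (k + 2)%:R in err K0 *.
have K2 : 2 <= K by rewrite ler_nat; lia.
apply: (@le_trans _ _ (2 / K * (1 - 1 / K))).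
  set v := 2 / K in err *; have -> : 1 / K = v / 2 by rewrite /v; field; rewrite gt_eqF.
  have v1 : v <= 1 by rewrite ler_pdivrMr // mul1r.
  rewrite e'; apply: (@le_trans _ _ ((a - s) * (1 - (a - s) / 2))).
    by rewrite ler_wpM2l ?subr_ge0 //; lra.
  by have := mulr_ge0 (_ : 0 <= v - (a - s)) (_ : 0 <= 2 - v - (a - s)); nra.
rewrite -subr_ge0; have -> : 2 / (K + 1) - 2 / K * (1 - 1 / K) = 2 / (K ^+ 2 * (K + 1)).
  by field; rewrite !gt_eqF //; lra.
by rewrite divr_ge0 // mulr_ge0 ?sqr_ge0 //; lra.
Qed.

(** Real trigonometric polynomials, as real parts of analytic ones. *)
Definition re_poly A := exists q, forall z, normc z = 1 -> A z = complex.Re q.[z].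

Lemma re_poly_ext A B :
  (forall z, normc z = 1 -> A z = B z) -> re_poly A -> re_poly B.
Proof. by move=> e [q Aq]; exists q => z z1; rewrite -e // Aq. Qed.

Lemma re_poly_Re q : re_poly (fun z => complex.Re q.[z]).
Proof. by exists q. Qed.

Lemma re_polyD A B : re_poly A -> re_poly B -> re_poly (fun z => A z + B z).
Proof.
move=> [q Aq] [r Br]; exists (q + r) => z z1.
by rewrite hornerD ReD Aq ?Br.
Qed.

Lemma re_polyZ (a : R) A : re_poly A -> re_poly (fun z => a * A z).
Proof.
by move=> [q Aq]; exists (a%:C *: q) => z z1; rewrite hornerZ Re_realM Aq.
Qed.

Lemma re_poly_const (a : R) : re_poly (fun=> a).
Proof. by exists (a%:C)%:P => z _; rewrite hornerC. Qed.

Lemma re_poly_sum n (A : nat -> R[i] -> R) :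
  (forall i, re_poly (A i)) -> re_poly (fun z => \sum_(i < n) A i z).
Proof.
move=> rA; elim: n => [|n IH].
  by apply: re_poly_ext (re_poly_const 0) => z _; rewrite big_ord0.
apply: re_poly_ext (re_polyD IH (rA n)) => z _; by rewrite big_ord_recr.
Qed.

(** On the unit circle [z^i * conj z^j] is [z^(i-j)] or the conjugate of
    [z^(j-i)], whose real parts are both of the required form. *)
Lemma re_poly_monomial (c : R[i]) i j :
  re_poly (fun z => complex.Re (c * (z ^+ i * (z^*%C) ^+ j))).
Proof.
case: (leqP j i) => ij.
  exists (c *: 'X^(i - j)) => z z1; rewrite hornerZ hornerXn.
  by rewrite -{1}(subnK ij) exprD -mulrA -exprMn conj_mul_circle // expr1n mulr1.
exists (c^*%C *: 'X^(j - i)) => z z1; rewrite hornerZ hornerXn.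
transitivity (complex.Re ((c^*%C * z ^+ (j - i))^*%C)); last exact: Re_conjc.
rewrite rmorphM rmorphXn /= conjcK -{1}(subnK (ltnW ij)) exprD.
by rewrite [z ^+ i * _]mulrCA -exprMn conj_mul_circle // expr1n mulr1.
Qed.

(** [2 Re u Re v = Re (u v) + Re (u conj v)]. *)
Lemma re_polyM A B : re_poly A -> re_poly B -> re_poly (fun z => A z * B z).
Proof.
move=> [q Aq] [r Br].
pose D z := \sum_(i < size q) \sum_(j < size r)
  complex.Re ((q`_i * (r`_j)^*%C) * (z ^+ i * (z^*%C) ^+ j)).
have rD : re_poly D.
  pose T i j z := complex.Re ((q`_i * (r`_j)^*%C) * (z ^+ i * (z^*%C) ^+ j)).
  apply: (@re_poly_sum (size q) (fun i z => \sum_(j < size r) T i j z)) => i.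
  by apply: (@re_poly_sum (size r) (T i)) => j; exact: re_poly_monomial.
apply: re_poly_ext (re_polyZ (1 / 2) (re_polyD (re_poly_Re (q * r)) rD)) => z z1.
rewrite Aq // Br // hornerM.
have -> : D z = complex.Re (q.[z] * (r.[z])^*%C).
  rewrite !horner_coef rmorph_sum mulr_suml Re_sum; apply: eq_bigr => i _.
  rewrite mulr_sumr Re_sum; apply: eq_bigr => j _.
  by rewrite rmorphM rmorphXn /=; congr (complex.Re _); ring.
by case: q.[z] => a b; case: r.[z] => c d /=; field.
Qed.

Lemma re_poly_sqr_normc f : re_poly (fun z => normc f.[z] ^+ 2).
Proof.
have rIm : re_poly (fun z => complex.Im f.[z]).
  exists (- 'i%C *: f) => z _; rewrite hornerZ.
  by case: f.[z] => a b /=; ring.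
apply: re_poly_ext (re_polyD (re_polyM (re_poly_Re f) (re_poly_Re f)) (re_polyM rIm rIm)).
by move=> z _; rewrite sqr_normcE !expr2.
Qed.

Lemma re_poly_sqrt_iter k A : re_poly A -> re_poly (fun z => sqrt_iter k (A z)).
Proof.
move=> rA; elim: k => [|k IH] /=; first exact: re_poly_const.
apply: re_poly_ext
  (re_polyD IH (re_polyZ (1 / 2) (re_polyD rA (re_polyZ (-1) (re_polyM IH IH))))).
by move=> z _; field.
Qed.

(** [|f|] is uniformly close to the real part of an analytic polynomial: write
    it as a polynomial in [|f|^2] up to a small error. *)
Lemma one_sided_modulus f (d : R) : 0 < d ->
  (forall z, normc z = 1 -> normc f.[z] <= 1) ->
  exists h, complex.Im h`_0 = 0 /\ forall z, normc z = 1 ->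
    normc f.[z] <= complex.Re h.[z] <= normc f.[z] + d.
Proof.
move=> d0 f1; set k := Num.bound (2 / d).
have [q qE] := re_polyD (re_poly_sqrt_iter k (re_poly_sqr_normc f)) (re_poly_const d).
have kd : 2 / (k + 2)%:R <= d.
  rewrite ler_pdivrMr ?ltr0n ?addn2 // -ler_pdivrMl // mulrC.
  have : 2 / d < k%:R by apply: archi_boundP; rewrite divr_ge0 // ltW.
  by rewrite -addn2 natrD; lra.
exists (q - ('i%C * (complex.Im q`_0)%:C)%:P); split.
  by rewrite coefB coefC eqxx; case: q`_0 => a b /=; ring.
move=> z z1; rewrite hornerD hornerN hornerC ReB -qE //.
have -> : complex.Re ('i%C * (complex.Im q`_0)%:C) = 0 by case: q`_0 => a b /=; ring.
have [/andP[s0 s1] s2] : _ /\ _ := @sqrt_iter_bounds k _ (introT andP (conj (normc_ge0 f.[z]) (f1 z z1))).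
by apply/andP; split; lra.
Qed.

(** [(1 - x / n) (1 + x / n) <= 1], and [(1 + x / n) ^ n >= 1 + x]. *)
Lemma bernoulli_decay n (x : R) : (0 < n)%N -> 0 <= x <= 1 ->
  (1 - x / n%:R) ^+ n <= (1 + x)^-1.
Proof.
move=> n0 /andP[x0 x1]; have N0 : (0 : R) < n%:R by rewrite ltr0n.
set y := x / n%:R; have y0 : 0 <= y by rewrite divr_ge0 ?ler0n.
have y1 : y <= 1 by rewrite ler_pdivrMr // mul1r (le_trans x1) // ler1n.
have bern m : 1 + m%:R * y <= (1 + y) ^+ m.
  elim: m => [|m IH]; first by rewrite mul0r addr0 expr0.
  rewrite exprSr; apply: le_trans (ler_wpM2r (_ : 0 <= 1 + y) IH); last lra.
  rewrite -[m.+1%:R]natr1; have := mulr_ge0 (ler0n R m) (sqr_ge0 y); lra.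
have nb : 1 + x <= (1 + y) ^+ n by rewrite (le_trans _ (bern n)) // mulrC divfK ?gt_eqF.
rewrite -[_^-1]mul1r ler_pdivlMr; last lra.
apply: le_trans (ler_wpM2l _ nb) _; first by rewrite exprn_ge0 //; lra.
rewrite -exprMn exprn_ile1 //; first by rewrite mulr_ge0; lra.
by have := sqr_ge0 y; lra.
Qed.

Lemma horner_bound h : exists b : R, forall z, normc z = 1 -> normc h.[z] <= b.
Proof.
exists (\sum_(i < size h) normc h`_i) => z z1; rewrite horner_coef.
apply: le_trans (normc_sum _ _ _) _; apply: ler_sum => i _.
by rewrite normcM normcX z1 expr1n mulr1.
Qed.

(** The damping factor of McGehee, Pigno and Smith. It plays the role of
    [exp (- h / 12)], where [Re h] is slightly larger than [|f|]; replacing the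
    exponential by [(1 - h / (12 n)) ^ n] keeps it a polynomial, and for [n]
    large the excess of [Re h] over [|f|] absorbs the second order terms. *)
Lemma damping_factor f (d : R) : 0 < d ->
  (forall z, normc z = 1 -> normc f.[z] <= 1) ->
  exists g h, complex.Im h`_0 = 0 /\ forall z, normc z = 1 ->
    [/\ normc g.[z] <= 1 - normc f.[z] / 14,
        normc (g.[z] - 1) <= normc h.[z] / 12
      & 0 <= complex.Re h.[z] <= normc f.[z] + d].
Proof.
move=> d0 f1; have d20 : 0 < d / 2 by lra.
have [h' [h'0 h'P]] := one_sided_modulus d20 f1.
pose h := h' + ((d / 2)%:C)%:P.
have hP z : normc z = 1 -> normc f.[z] + d / 2 <= complex.Re h.[z] <= normc f.[z] + d.
  by move=> z1; rewrite hornerD hornerC ReD /=; have /andP[] := h'P z z1; lra.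
have [b hB] := horner_bound h.
(* With [n >= b^2 / d] the quadratic term of [|1 - h / (12 n)|^2] is smaller
   than the gain from [Re h >= |f| + d / 2]. *)
set n := (Num.bound (b ^+ 2 / d)).+1.
have n0 : (0 : R) < n%:R by rewrite ltr0n.
have nB : b ^+ 2 <= d * n%:R.
  rewrite -ler_pdivrMl // mulrC ltW // (lt_le_trans (archi_boundP _)) ?ler_nat //.
  by rewrite divr_ge0 ?sqr_ge0 // ltW.
pose e : R := (12 * n%:R)^-1.
pose g := (1 - e%:C *: h) ^+ n.
exists g, h; split; first by rewrite coefD coefC eqxx; move: h'0; case: h'`_0 => u v /= ->; rewrite addr0.
move=> z z1; have /andP[hl hu] := hP z z1.
have f0 := normc_ge0 f.[z]; have fle := f1 z z1.
pose y := 1 - e%:C * h.[z].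
have gE : g.[z] = y ^+ n by rewrite horner_exp hornerD hornerN hornerZ hornerC.
have e0 : 0 < e by rewrite invr_gt0 mulr_gt0.
have en : e * n%:R = 12^-1 by rewrite /e; field; rewrite gt_eqF.
have y2 : normc y ^+ 2 <= 1 - (normc f.[z] / 6) / n%:R.
  have -> : normc y ^+ 2 = 1 - 2 * e * complex.Re h.[z] + e ^+ 2 * normc h.[z] ^+ 2.
    by rewrite !sqr_normcE /y; case: h.[z] => u v /=; ring.
  have : e ^+ 2 * normc h.[z] ^+ 2 <= e * d / 12.
    rewrite (_ : e * d / 12 = e ^+ 2 * (d * n%:R)); last by rewrite -en; ring.
    rewrite ler_wpM2l ?sqr_ge0 // (le_trans _ nB) //.
    by rewrite ler_pXn2r ?nnegrE ?normc_ge0 ?hB // (le_trans (normc_ge0 h.[z])) ?hB.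
  have -> : normc f.[z] / 6 / n%:R = 2 * e * normc f.[z] by rewrite /e; field; rewrite gt_eqF.
  have := ler_wpM2l (ltW e0) hl; have := mulr_ge0 (ltW e0) (ltW d0); lra.
have y1 : normc y <= 1.
  rewrite -(ler_pXn2r (n := 2)) ?nnegrE ?normc_ge0 // expr1n.
  by apply: le_trans y2 _; rewrite gerBl !divr_ge0 ?ler0n.
split; last by apply/andP; split => //; lra.
- have g2 : normc g.[z] ^+ 2 <= (1 + normc f.[z] / 6)^-1.
    rewrite gE normcX exprAC (le_trans _ (bernoulli_decay _ (n := n) _)) //.
      by rewrite lerXn2r ?nnegrE ?sqr_ge0 // (le_trans _ y2) ?sqr_ge0.
    by apply/andP; split; lra.
  rewrite -(ler_pXn2r (n := 2)) ?nnegrE ?normc_ge0 //; last lra.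
  apply: le_trans g2 _; rewrite -[_^-1]mul1r ler_pdivrMr; last lra.
  move: (normc f.[z]) f0 fle => x x0 x1.
  have := mulr_ge0 x0 (_ : 0 <= 1 - x); rewrite subr_ge0 => /(_ x1).
  have := mulr_ge0 (sqr_ge0 x) x0; lra.
- rewrite gE subrX1 normcM.
  have -> : normc (y - 1) = e * normc h.[z].
    by rewrite /y addrAC subrr sub0r normcN normcM normc_real gtr0_norm.
  rewrite -mulrA mulrCA ler_wpM2l ?normc_ge0 // -en ler_wpM2l ?(ltW e0) //.
  apply: le_trans (normc_sum _ _ _) _.
  rewrite -[n in X in _ <= X](card_ord n) -sumr_const; apply: ler_sum => i _.
  by rewrite normcX exprn_ile1 ?normc_ge0.
Qed.

(** The average of [h ^ 2] is the square of its real constant term, hence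
    nonnegative: the mean of [(Im h)^2] is at most that of [(Re h)^2]. *)
Lemma conjugate_function_L2 P h : (2 * size h <= P)%N -> complex.Im h`_0 = 0 ->
  avg P (fun z => normc h.[z] ^+ 2) <= 2 * avg P (fun z => complex.Re h.[z] ^+ 2).
Proof.
move=> hP h0; have [->|hn0] := eqVneq h 0.
  under eq_avg => z do rewrite horner0 normc0 expr0n.
  rewrite {1}/avg big1 // mulr0 mulr_ge0 //; apply: avg_ge0 => t; exact: sqr_ge0.
have P0 : (0 < P)%N by move: hP; rewrite -size_poly_gt0 in hn0; lia.
have : avg P (fun z => complex.Re (h.[z] ^+ 2)) = complex.Re h`_0 ^+ 2.
  rewrite -Re_avg; have := @avg_coef R P (h ^+ 2) 0 _ P0.
  under eq_avg => z do rewrite expr0 mulr1 horner_exp.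
  move=> ->; first by rewrite expr2 coef0M -expr2; case: h`_0 h0 => a b /= ->; ring.
  by rewrite expr2 (leq_trans (size_polyMleq _ _)) //; lia.
have -> : avg P (fun z => complex.Re (h.[z] ^+ 2)) =
    2 * avg P (fun z => complex.Re h.[z] ^+ 2) - avg P (fun z => normc h.[z] ^+ 2).
  rewrite -mulN1r -!avgZ -avgD; apply: eq_avg => z; rewrite sqr_normcE.
  by case: h.[z] => a b /=; ring.
by have := sqr_ge0 (complex.Re h`_0); lra.
Qed.

End OneSided.

(** * Littlewood's inequality *)

Section Littlewood.
Context {R : realType}.
Implicit Types (m j k : nat) (z : R[i]).

(** The exponents are cut into consecutive blocks of sizes [4 ^ j]. *)
Definition block_start m := (\sum_(j < m) 4 ^ j)%N.

Lemma block_startS m : block_start m.+1 = (block_start m + 4 ^ m)%N.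
Proof. by rewrite /block_start big_ord_recr. Qed.

Lemma leq_block_start : {homo block_start : i j / (i <= j)%N}.
Proof.
move=> i j /subnKC <-; elim: (j - i)%N => [|d IH]; rewrite ?addn0 // addnS.
by rewrite block_startS (leq_trans IH) ?leq_addr.
Qed.

Lemma block_find m k : (k < block_start m)%N ->
  exists2 j, (j < m)%N & (block_start j <= k < block_start j.+1)%N.
Proof.
elim: m => [|m IH]; first by rewrite /block_start big_ord0.
case: (ltnP k (block_start m)) => [/IH [j jm jk] _|mk km].
  by exists j; rewrite ?(ltnW jm) ?ltnS ?(ltnW jm).
by exists m; rewrite ?mk.
Qed.

Context (N m : nat) (n : nat -> nat) (c : nat -> R[i]).
Context (n_decr : forall i j, (i < j < N)%N -> (n j < n i)%N).
Context (c_ge1 : forall k, (k < N)%N -> 1 <= normc (c k)).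
Context (m_le : (block_start m <= N)%N).

Definition sparse_poly (a : nat -> R[i]) : {poly R[i]} :=
  \sum_(k < N) a k *: 'X^(n k).

Lemma exponent_inj i j : (i < N)%N -> (j < N)%N -> (n i == n j) = (i == j).
Proof.
move=> iN jN; case: (ltngtP i j) => [ij|ji|->]; last by rewrite eqxx.
  by apply/eqP => e; have := @n_decr i j; rewrite ij jN e ltnn => /(_ isT).
by apply/eqP => e; have := @n_decr j i; rewrite ji iN e ltnn => /(_ isT).
Qed.

Lemma coef_sparse_poly a k : (k < N)%N -> (sparse_poly a)`_(n k) = a k.
Proof.
move=> kN; rewrite coef_sum (bigD1 (Ordinal kN)) //= coefZ coefXn eqxx mulr1.
rewrite big1 ?addr0 // => i ne; rewrite coefZ coefXn exponent_inj // eq_sym.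
by move: ne; rewrite -val_eqE /= => /negbTE ->; rewrite mulr0.
Qed.

Lemma coef_sparse_poly_below a s k :
  (forall i, (i < N)%N -> a i != 0 -> (i < k)%N) -> (k < N)%N -> (s <= n k)%N ->
  (sparse_poly a)`_s = 0.
Proof.
move=> ak kN sk; rewrite coef_sum big1 // => i _; rewrite coefZ coefXn.
have [->|a0] := eqVneq (a i) 0; first by rewrite mul0r.
case: eqP => [e|]; last by rewrite mulr0.
by have := @n_decr i k; rewrite (ak _ (ltn_ord i) a0) kN => /(_ isT); lia.
Qed.

Lemma normc_sparse_poly a z : normc z = 1 ->
  normc (sparse_poly a).[z] <= \sum_(k < N) normc (a k).
Proof.
move=> z1; rewrite horner_sum; apply: le_trans (normc_sum _ _ _) _.
by apply: ler_sum => i _; rewrite hornerZ hornerXn normcM normcX z1 expr1n mulr1.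
Qed.

Lemma avg_sparse_inner P a (q : {poly R[i]}) : (size q <= P)%N ->
  (forall k, (k < N)%N -> (n k < P)%N) ->
  avg P (fun z => (sparse_poly a).[z] * (q.[z])^*%C) =
  \sum_(k < N) a k * (q`_(n k))^*%C.
Proof.
move=> qP nP.
under eq_avg => z do rewrite horner_sum mulr_suml.
rewrite avg_sum; apply: eq_bigr => k _.
under eq_avg => z do rewrite hornerZ hornerXn -mulrA.
rewrite avgZ -[q`__](avg_coef qP (nP _ (ltn_ord k))) /avg; congr (_ * _).
rewrite rmorphM fmorphV rmorph_nat rmorph_sum; congr (_ * _).
apply: eq_bigr => t _; move: (unity P t) => z.
by rewrite rmorphM rmorphXn /= conjcK mulrC.
Qed.

(** Makes each block polynomial bounded by [1] on the circle, with mean square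
    [4 ^- j]. *)
Definition weight j : R := (4 ^+ j)^-1.

Lemma weight_gt0 j : 0 < weight j.
Proof. by rewrite invr_gt0 exprn_gt0. Qed.

Lemma weightS j : weight j.+1 = weight j / 4.
Proof. by rewrite /weight exprS; field; rewrite expf_neq0 ?pnatr_eq0. Qed.

Definition in_block j k := (block_start j <= k < block_start j.+1)%N.

(** The phases of [c] on the [j]-th block, so that pairing with [c] yields the
    moduli of its coefficients. *)
Definition block_coef j k : R[i] :=
  if in_block j k then (weight j / normc (c k))%:C * c k else 0.

Definition block_poly j := sparse_poly (block_coef j).

Lemma normc_block_coef j k : (k < N)%N ->
  normc (block_coef j k) = if in_block j k then weight j else 0.
Proof.
move=> kN; rewrite /block_coef; case: ifP => _; last by rewrite normc0.
have c0 : 0 < normc (c k) by rewrite (lt_le_trans _ (c_ge1 kN)).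
by rewrite normcM normc_real gtr0_norm ?divr_gt0 ?weight_gt0 // divfK ?gt_eqF.
Qed.

Lemma sum_in_block j (w : R) : (j < m)%N ->
  \sum_(k < N) (if in_block j k then w else 0) = 4 ^+ j * w.
Proof.
move=> jm.
have initial b : (b <= N)%N -> \sum_(k < N) (if (k < b)%N then w else 0) = b%:R * w.
  move=> bN; rewrite -big_mkcond /= -(big_ord_widen _ (fun=> w)) //.
  by rewrite sumr_const card_ord mulr_natl.
have bN : (block_start j.+1 <= N)%N by rewrite (leq_trans (leq_block_start jm)).
have bb := leq_block_start (leqnSn j).
have -> : 4 ^+ j * w = (block_start j.+1)%:R * w - (block_start j)%:R * w.
  by rewrite block_startS natrD natrX; ring.
rewrite -!initial ?(leq_trans bb) // -sumrB; apply: eq_bigr => k _.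
rewrite /in_block; case: (ltnP k (block_start j)) => kj /=.
  by rewrite (leq_trans kj bb) subrr.
by case: ifP; rewrite subr0.
Qed.

Lemma sum_normc_block j : (j < m)%N -> \sum_(k < N) normc (block_coef j k) = 1.
Proof.
move=> jm; under eq_bigr => k _ do rewrite normc_block_coef //.
by rewrite sum_in_block // divff // expf_neq0 ?pnatr_eq0.
Qed.

Lemma block_poly_le1 j z : (j < m)%N -> normc z = 1 -> normc (block_poly j).[z] <= 1.
Proof. by move=> jm z1; rewrite -(sum_normc_block jm) normc_sparse_poly. Qed.

Lemma block_poly_L2 P j : (j < m)%N -> (size (block_poly j) <= P)%N ->
  (forall k, (k < N)%N -> (n k < P)%N) ->
  avg P (fun z => normc (block_poly j).[z] ^+ 2) = weight j.
Proof.
move=> jm sP nP; apply: (@complexI R); rewrite -avg_real.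
under eq_avg => z do rewrite -mulc_conj.
rewrite avg_sparse_inner // (eq_bigr (fun k : 'I_N => (weight j * normc (block_coef j k))%:C)).
  by rewrite -rmorph_sum -mulr_sumr sum_normc_block // mulr1.
move=> k _; rewrite coef_sparse_poly // mulc_conj normc_block_coef //.
by case: ifP => _; rewrite ?mulr0 expr2 ?mulr0.
Qed.

Lemma block_poly_vanish j k s :
  (k < N)%N -> (block_start j.+1 <= k)%N -> (s <= n k)%N -> (block_poly j)`_s = 0.
Proof.
move=> kN jk sk; apply: (coef_sparse_poly_below _ kN sk) => i iN.
rewrite /block_coef; case: ifP => [/andP[_ ij] _|]; last by rewrite eqxx.
exact: leq_trans ij jk.
Qed.

Lemma block_coef_uniq i j k : in_block j k -> i != j -> block_coef i k = 0.
Proof.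
rewrite /block_coef /in_block => /andP[jk kj] ij; case: ifP => // /andP[ik ki].
case: (ltngtP i j) ij => // lt _; have := leq_block_start lt; lia.
Qed.

Section DualFunction.
(** [g j] is a damping factor for the [j]-th block polynomial. *)
Context (g h : nat -> {poly R[i]}).
Context (h0 : forall j, (j < m)%N -> complex.Im (h j)`_0 = 0).
Context (g_le : forall j z, (j < m)%N -> normc z = 1 ->
  normc (g j).[z] <= 1 - normc (block_poly j).[z] / 14).
Context (g_near1 : forall j z, (j < m)%N -> normc z = 1 ->
  normc ((g j).[z] - 1) <= normc (h j).[z] / 12).
Context (h_le : forall j z, (j < m)%N -> normc z = 1 ->
  0 <= complex.Re (h j).[z] <= normc (block_poly j).[z] + (2 ^+ j)^-1).

(** The dual function of McGehee, Pigno and Smith: before a new block is added,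
    the sum of the previous ones is damped where the new block is large. *)
Fixpoint dual_poly j : {poly R[i]} :=
  if j is i.+1 then dual_poly i * g i + block_poly i else 0.

Definition tail_factor j := \prod_(j.+1 <= k < m) g k.

Lemma dual_polyE j :
  dual_poly j = \sum_(i < j) block_poly i * \prod_(i.+1 <= k < j) g k.
Proof.
elim: j => [|j IH] /=; first by rewrite big_ord0.
rewrite big_ord_recr /= big_geq // mulr1 IH mulr_suml; congr (_ + _).
by apply: eq_bigr => i _; rewrite big_nat_recr //= mulrA.
Qed.

(** The bound is self-propagating: [14 (1 - |f| / 14) + |f| = 14]. *)
Lemma dual_poly_le j z : (j <= m)%N -> normc z = 1 -> normc (dual_poly j).[z] <= 14.
Proof.
move=> + z1; elim: j => [|j IH] jm /=; first by rewrite horner0 normc0.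
rewrite hornerD hornerM; apply: le_trans (le_normcD _ _) _.
have := ler_pM (normc_ge0 _) (normc_ge0 _) (IH (ltnW jm)) (g_le jm z1).
rewrite -normcM; lra.
Qed.

Lemma g_le1 j z : (j < m)%N -> normc z = 1 -> normc (g j).[z] <= 1.
Proof.
move=> jm z1; apply: le_trans (g_le jm z1) _.
by rewrite gerBl divr_ge0 ?normc_ge0.
Qed.

Lemma tail_factor_near1 j z : normc z = 1 ->
  normc ((tail_factor j).[z] - 1) <= \sum_(j.+1 <= k < m) normc (h k).[z] / 12.
Proof.
move=> z1; rewrite /tail_factor.
have main r : (r <= m)%N -> (j < r)%N ->
    normc ((\prod_(j.+1 <= k < r) g k).[z]) <= 1 /\
    normc ((\prod_(j.+1 <= k < r) g k).[z] - 1) <= \sum_(j.+1 <= k < r) normc (h k).[z] / 12.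
  elim: r => // r IH rm; rewrite ltnS leq_eqVlt => /orP[/eqP ->|jr].
    by rewrite !big_geq // hornerC normc1 subrr normc0.
  have [IH1 IH2] := IH (ltnW rm) jr; rewrite !big_nat_recr //= hornerM; split.
    by rewrite normcM mulr_ile1 ?normc_ge0 // g_le1.
  set u := (\prod_(_ <= _ < _) _).[z] in IH1 IH2 *.
  have -> : u * (g r).[z] - 1 = (u - 1) + u * ((g r).[z] - 1) by ring.
  apply: le_trans (le_normcD _ _) _; apply: lerD => //.
  rewrite normcM; apply: le_trans (g_near1 rm z1).
  by rewrite ler_piMl ?normc_ge0.
case: (ltnP j m) => jm; first by have [] := main m (leqnn _) jm.
by rewrite !big_geq ?hornerC ?subrr ?normc0 // ltnW.
Qed.

Context (P : nat).
Context (P_exp : forall k, (k < N)%N -> (n k < P)%N).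
Context (P_block : forall j, (j < m)%N -> (size (block_poly j) <= P)%N).
Context (P_h : forall j, (j < m)%N -> (2 * size (h j) <= P)%N).
Context (P_tail : forall j, (j < m)%N ->
  (size (block_poly j * (tail_factor j - 1))%R <= P)%N).
Context (P_dual : (size (dual_poly m) <= P)%N).

(** [|h|^2] has mean at most twice that of [(Re h)^2 <= 2 |f|^2 + 2 * 4 ^- j]. *)
Lemma h_L2 j : (j < m)%N -> avg P (fun z => normc (h j).[z] ^+ 2) <= 8 * weight j.
Proof.
move=> jm; apply: le_trans (conjugate_function_L2 (P_h jm) (h0 jm)) _.
have N0 : (0 < N)%N.
  apply: leq_trans m_le; apply: leq_trans (leq_block_start jm).
  by rewrite block_startS addn_gt0 expn_gt0 orbT.
have P0 := leq_ltn_trans (leq0n _) (P_exp N0).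
suff : avg P (fun z => complex.Re (h j).[z] ^+ 2) <= 4 * weight j by lra.
have -> : 4 * weight j = 2 * weight j + 2 * weight j by lra.
rewrite -{1}(block_poly_L2 jm (P_block jm) P_exp) -avgZ -[X in _ <= _ + X](avg_const _ P0) -avgD.
apply: le_avg => t; have /andP[] := h_le jm (normc_unity P t).
move: (complex.Re _) (normc _) => x y x0 xy.
have -> : weight j = ((2 ^+ j)^-1) ^+ 2.
  by rewrite /weight exprVn -exprM mulnC exprM; congr (_ ^-1); congr (_ ^+ _); ring.
move: (2 ^+ j)^-1 xy => d xy.
have : x ^+ 2 <= (y + d) ^+ 2 by rewrite ler_pXn2r // nnegrE (le_trans x0).
have := sqr_ge0 (y - d); lra.
Qed.

(** By AM-GM with the weights [2 ^ (i - k)], the tail contributes at most a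
    geometric series. *)
Lemma tail_coef_small i s : (i < m)%N -> (s < P)%N ->
  normc (block_poly i * (tail_factor i - 1))`_s <= 3 / 8 * weight i.
Proof.
move=> im sP; rewrite -(avg_coef (P_tail im) sP).
apply: le_trans (normc_avg _ _) _.
pose d k : R := (2 ^+ k)^-1.
have d0 k : 0 < d k by rewrite invr_gt0 exprn_gt0.
have wd k : weight k = d k ^+ 2.
  by rewrite /d /weight exprVn -exprM mulnC exprM; congr (_ ^-1); congr (_ ^+ _); ring.
apply: le_trans (le_avg (g' := fun z => \sum_(i.+1 <= k < m)
   (1 / 24 * (d k / d i) * normc (block_poly i).[z] ^+ 2 +
    1 / 24 * (d i / d k) * normc (h k).[z] ^+ 2)) _) _.
  move=> t; move: (@unity R P t) (@normc_unity R P t) => {t} z z1.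
  rewrite hornerM hornerD hornerN hornerC normcM normcX normc_conj z1 expr1n mulr1 normcM.
  apply: le_trans (ler_wpM2l (normc_ge0 _) (tail_factor_near1 _ z1)) _.
  rewrite mulr_sumr; apply: ler_sum => k _.
  move: (normc _) (normc (h k).[z]) => x y.
  have dk := d0 k; have di := d0 i.
  rewrite -subr_ge0.
  have -> : 1 / 24 * (d k / d i) * x ^+ 2 + 1 / 24 * (d i / d k) * y ^+ 2 - x * (y / 12)
     = 1 / 24 * (d i * d k)^-1 * (d k * x - d i * y) ^+ 2.
    by field; rewrite !gt_eqF.
  by rewrite mulr_ge0 ?sqr_ge0 // mulr_ge0 ?invr_ge0 ?mulr_ge0 // ltW.
rewrite avg_sum.
apply: (@le_trans _ _ (\sum_(i.+1 <= k < m) (3 / 8 * d i) * d k)).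
  rewrite big_nat_cond [X in _ <= X]big_nat_cond; apply: ler_sum => k /andP[/andP[_ km] _].
  rewrite avgD !avgZ (block_poly_L2 im (P_block im) P_exp).
  have dk := d0 k; have di := d0 i.
  have -> : 3 / 8 * d i * d k = 1 / 24 * (d k / d i) * weight i + 1 / 24 * (d i / d k) * (8 * weight k).
    by rewrite !wd; field; rewrite !gt_eqF.
  by rewrite lerD2l ler_wpM2l ?h_L2 // mulr_ge0 // divr_ge0 ?(ltW di) ?(ltW dk).
rewrite -mulr_sumr wd expr2 [3 / 8 * (_ * _)]mulrA ler_wpM2l //.
  by rewrite mulr_ge0 // ltW.
have : \sum_(i.+1 <= k < m) d k = d i - d m.-1.
  elim: (m) im => // r IH; rewrite ltnS leq_eqVlt => /orP[/eqP ->|ir].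
    by rewrite big_geq // subrr.
  rewrite big_nat_recr //= IH //; have -> : d r.-1 = 2 * d r; last by ring.
  by rewrite -(ltn_predK ir) /= /d exprS; field; rewrite expf_neq0 ?pnatr_eq0.
by move=> ->; rewrite gerBl ltW.
Qed.

Lemma sum_weight j r : \sum_(j <= i < r) weight i <= 4 / 3 * weight j.
Proof.
suff : (j <= r)%N -> \sum_(j <= i < r) weight i = 4 / 3 * (weight j - weight r).
  move=> e; case: (leqP j r) => jr.
    by rewrite e //; have := weight_gt0 r; lra.
  by rewrite big_geq ?(ltnW jr) // mulr_ge0 // ltW ?weight_gt0.
elim: r => [|r IH]; first by rewrite leqn0 => /eqP ->; rewrite big_geq // subrr mulr0.
rewrite leq_eqVlt => /orP[/eqP ->|jr]; first by rewrite big_geq // subrr mulr0.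
by rewrite big_nat_recr //= IH // weightS; field.
Qed.

(** The exponents decrease from one block to the next and the tail factors only
    raise degrees, so an earlier block does not reach a later exponent. *)
Lemma block_tail_vanish i k : (k < N)%N -> (block_start i.+1 <= k)%N ->
  (block_poly i * tail_factor i)`_(n k) = 0.
Proof.
move=> kN ik; rewrite coefM big1 // => s _.
by rewrite (block_poly_vanish kN ik) ?mul0r // -ltnS ltn_ord.
Qed.

(** Only the blocks [i >= j] contribute to the coefficient, each by at most
    [3 / 8 * 4 ^- i], for a total of at most [4 / 3 * 3 / 8 = 1 / 2] times
    [4 ^- j]. *)
Lemma dual_coef_in j k : (j < m)%N -> (k < N)%N -> in_block j k ->
  normc ((dual_poly m)`_(n k) - block_coef j k) <= weight j / 2.
Proof.
move=> jm kN jk.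
have -> : (dual_poly m)`_(n k) - block_coef j k =
    \sum_(j <= i < m) (block_poly i * (tail_factor i - 1))`_(n k).
  have -> : block_coef j k = \sum_(i < m) (block_poly i)`_(n k).
    rewrite (bigD1 (Ordinal jm)) //= big1 ?addr0 ?coef_sparse_poly // => i ne.
    by rewrite coef_sparse_poly // (block_coef_uniq jk).
  rewrite dual_polyE coef_sum -sumrB.
  rewrite -(big_mkord predT (fun i => (block_poly i * tail_factor i)`_(n k) - (block_poly i)`_(n k))).
  rewrite (big_cat_nat _ (n := j)) ?(ltnW jm) //= big_nat_cond big1 ?add0r.
    by apply: eq_bigr => i _; rewrite mulrBr mulr1 coefB.
  move=> i /andP[/andP[_ ij] _]; have ik : (block_start i.+1 <= k)%N.
    by case/andP: jk => jk _; rewrite (leq_trans _ jk) // leq_block_start.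
  by rewrite block_tail_vanish // (block_poly_vanish kN ik) // subrr.
apply: le_trans (normc_sum _ _ _) _.
apply: (@le_trans _ _ (3 / 8 * \sum_(j <= i < m) weight i)); last first.
  by have := sum_weight j m; lra.
rewrite mulr_sumr big_nat_cond [X in _ <= X]big_nat_cond.
by apply: ler_sum => i /andP[/andP[_ im] _]; apply: tail_coef_small => //; exact: P_exp.
Qed.

Lemma dual_coef_out k : (k < N)%N -> (block_start m <= k)%N -> (dual_poly m)`_(n k) = 0.
Proof.
move=> kN mk; rewrite dual_polyE coef_sum big1 // => i _; apply: block_tail_vanish => //.
by rewrite (leq_trans _ mk) // leq_block_start.
Qed.

Lemma dual_pairing k : (k < N)%N ->
  1 / 2 * \sum_(j < m) normc (block_coef j k) <=
  complex.Re (c k * ((dual_poly m)`_(n k))^*%C).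
Proof.
move=> kN; case: (ltnP k (block_start m)) => [/block_find [j jm jk]|mk]; last first.
  rewrite dual_coef_out // conjc0 mulr0 big1 ?mulr0 // => i _.
  rewrite normc_block_coef // ifF //; apply/negP => /andP[_ ki].
  by have := leq_block_start (ltn_ord i); lia.
rewrite (bigD1 (Ordinal jm)) //= big1 ?addr0 => [|i ne]; last first.
  by rewrite (block_coef_uniq jk) ?normc0.
have {}jk : in_block j k := jk.
have e := dual_coef_in jm kN jk.
set d := _ - _ in e.
have -> : ((dual_poly m)`_(n k))^*%C = (block_coef j k)^*%C + d^*%C.
  by rewrite -(rmorphD (@conjc R)) addrC subrK.
rewrite mulrDr ReD normc_block_coef // jk.
have ck : 0 < normc (c k) by rewrite (lt_le_trans _ (c_ge1 kN)).
have -> : complex.Re (c k * (block_coef j k)^*%C) = weight j * normc (c k).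
  rewrite /block_coef jk; set a := weight j / _.
  have -> : (a%:C * c k)^*%C = a%:C * (c k)^*%C.
    by case: (c k) => v w; apply/eqP; rewrite eq_complex /=; apply/andP; split; apply/eqP; ring.
  by rewrite mulrCA mulc_conj Re_realM /a /=; field; rewrite gt_eqF.
have := abs_Re_le (c k * d^*%C).
rewrite normcM normc_conj ler_norml => /andP[lo _].
have := ler_wpM2l (ltW ck) e; have := ler_wpM2l (ltW (weight_gt0 j)) (c_ge1 kN).
lra.
Qed.

(** The pairing of the sum with the dual function is at most [14] times the
    mean modulus of the former, and at least [1 / 2] for each block. *)
Lemma littlewood_dual :
  m%:R <= 28 * avg P (fun z => normc (sparse_poly c).[z]).
Proof.
have up : complex.Re (avg P (fun z => (sparse_poly c).[z] * ((dual_poly m).[z])^*%C)) <=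
    14 * avg P (fun z => normc (sparse_poly c).[z]).
  apply: le_trans (Re_le _) _; apply: le_trans (normc_avg _ _) _.
  rewrite -avgZ; apply: le_avg => t; rewrite normcM normc_conj mulrC.
  by rewrite ler_wpM2r ?normc_ge0 // dual_poly_le ?normc_unity.
have : 1 / 2 * m%:R <= complex.Re (avg P (fun z => (sparse_poly c).[z] * ((dual_poly m).[z])^*%C)).
  rewrite avg_sparse_inner // Re_sum.
  apply: le_trans (_ : \sum_(k < N) 1 / 2 * \sum_(j < m) normc (block_coef j k) <= _); last first.
    by apply: ler_sum => k _; exact: dual_pairing.
  rewrite -mulr_sumr exchange_big /= (eq_bigr (fun=> 1)) => [|j _]; last exact: sum_normc_block.
  by rewrite sumr_const card_ord.
lra.
Qed.

End DualFunction.

(** Littlewood's inequality. The circle is replaced by the [P]-th roots of unity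
    with [P] exceeding the degrees of all the auxiliary polynomials, which do
    not depend on [P]. *)
Lemma littlewood_large :
  exists P0, forall P, (P0 <= P)%N ->
    m%:R <= 28 * avg P (fun z => normc (sparse_poly c).[z]).
Proof.
have /choice [gh ghP] : forall j, exists gh : {poly R[i]} * {poly R[i]}, (j < m)%N ->
    complex.Im gh.2`_0 = 0 /\ forall z, normc z = 1 ->
    [/\ normc gh.1.[z] <= 1 - normc (block_poly j).[z] / 14,
        normc (gh.1.[z] - 1) <= normc gh.2.[z] / 12
      & 0 <= complex.Re gh.2.[z] <= normc (block_poly j).[z] + (2 ^+ j)^-1].
  move=> j; case: (ltnP j m) => jm; last by exists (0, 0).
  have d0 : 0 < (2 ^+ j)^-1 :> R by rewrite invr_gt0 exprn_gt0.
  have [g [h gh]] := damping_factor d0 (fun z => @block_poly_le1 j z jm).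
  by exists (g, h).
pose g j := (gh j).1; pose h j := (gh j).2.
pose bound j := (size (block_poly j) + 2 * size (h j) +
  size (block_poly j * (tail_factor g j - 1))%R)%N.
exists (\sum_(k < N) (n k).+1 + \sum_(j < m) bound j + size (dual_poly g m))%N => P leP.
have bP j : (j < m)%N -> (bound j <= P)%N.
  move=> jm; apply: leq_trans leP.
  have : (bound j <= \sum_(i < m) bound i)%N by rewrite (bigD1 (Ordinal jm)) //= leq_addr.
  by move: (\sum_(i < m) _)%N => s; lia.
apply: (@littlewood_dual g h).
- by move=> j /ghP[].
- by move=> j z /ghP[_ gP] /gP[].
- by move=> j z /ghP[_ gP] /gP[].
- by move=> j z /ghP[_ gP] /gP[].
- move=> k kN; apply: leq_trans leP.
  by rewrite (bigD1 (Ordinal kN)) //= -!addnA leq_addr.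
- by move=> j /bP; rewrite /bound; lia.
- by move=> j /bP; rewrite /bound; lia.
- by move=> j /bP; rewrite /bound; lia.
- by apply: leq_trans leP; rewrite leq_addl.
Qed.

End Littlewood.

(** * Dissociated sets and the Wiener norm *)

Section SignedSums.
Context {V : zmodType}.
Implicit Types (s l : seq V) (x y : V).

Fixpoint signed_sums s : seq V :=
  if s is x :: s' then
    let t := signed_sums s' in t ++ [seq x + y | y <- t] ++ [seq y - x | y <- t]
  else [:: 0].

(** Equivalent to the usual definition, that no signed sum with signs not all
    zero vanishes: in such a sum the first element of the list with a nonzero
    sign would be a signed sum of the later ones. *)
Fixpoint dissociated s :=
  if s is x :: s' then (x \notin signed_sums s') && dissociated s' else true.

Lemma mem_signed_sums_cons x s y : (y \in signed_sums (x :: s)) =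
  [|| y \in signed_sums s, y - x \in signed_sums s | y + x \in signed_sums s].
Proof.
rewrite /= !mem_cat; congr [|| _, _ | _].
  by rewrite -{1}[y](subrK x) addrC mem_map // => u v /addrI.
by rewrite -{1}[y](addrK x) (mem_map (f := fun y => y - x)) // => u v /addIr.
Qed.

Lemma signed_sums0 s : 0 \in signed_sums s.
Proof.
elim: s => [|x s IH]; first by rewrite inE.
by rewrite mem_signed_sums_cons IH.
Qed.

(** Greedy choice: an element is added unless it is already a signed sum. *)
Lemma dissociated_basis l : exists s,
  [/\ {subset s <= l}, dissociated s & {subset l <= signed_sums s}].
Proof.
elim: l => [|x l [s [sl ds ls]]]; first by exists [::].
case: (boolP (x \in signed_sums s)) => xs.
  exists s; split => // y; rewrite inE; first by move/sl => ->; rewrite orbT.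
  by case/predU1P => [->|/ls].
exists (x :: s); split; last 2 first.
- by rewrite /= xs.
- move=> y; rewrite inE mem_signed_sums_cons => /predU1P[->|/ls -> //].
  by rewrite subrr signed_sums0 orbT.
- by move=> y; rewrite !inE => /predU1P[->|/sl ->]; rewrite ?eqxx ?orbT.
Qed.

End SignedSums.

Section FourierZp.
Context {R : realType} {p : nat} (p_gt1 : (1 < p)%N).
Implicit Types (f : 'Z_p -> R[i]) (x y xi : 'Z_p).

Let p_gt0 : (0 < p)%N := ltnW p_gt1.

Let pR_neq0 : (p%:R : R[i]) != 0.
Proof. by rewrite pnatr_eq0 -lt0n. Qed.

Definition chi x : R[i] := unity p x.

Let unity_Zp_modn k : unity p (k %% (Zp_trunc p).+2) = unity p k :> R[i].
Proof. by rewrite Zp_cast // unity_modn. Qed.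

Lemma chiD x y : chi (x + y) = chi x * chi y.
Proof. by rewrite /chi /= unity_Zp_modn unityD. Qed.

Lemma chiM x y : chi (x * y) = unity p (x * y)%N.
Proof. exact: unity_Zp_modn. Qed.

Lemma chi0 : chi 0 = 1.
Proof. by rewrite /chi unity0. Qed.

Lemma chiMn x n : chi (x *+ n) = chi x ^+ n.
Proof.
elim: n => [|n IH]; first by rewrite mulr0n chi0.
by rewrite mulrS chiD IH exprS.
Qed.

Lemma normc_chi x : normc (chi x) = 1.
Proof. exact: normc_unity. Qed.

Lemma chiN x : chi (- x) = (chi x)^*%C.
Proof.
have : chi x * chi (- x) = chi x * (chi x)^*%C.
  by rewrite -chiD subrr chi0 conj_mul_circle // normc_chi.
by apply: mulfI; rewrite -normc_eq0 normc_chi oner_eq0.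
Qed.

Lemma sum_Zp (W : nmodType) (F : nat -> W) :
  \sum_(x : 'Z_p) F x = \sum_(t < p) F t.
Proof. by rewrite -!(big_mkord xpredT F) Zp_cast. Qed.

Lemma sum_chi y : \sum_(xi : 'Z_p) chi (xi * y) = if y == 0 then p%:R else 0.
Proof.
under eq_bigr => xi _ do rewrite chiM.
rewrite (sum_Zp (fun t => unity p (t * y)%N)) sum_unity //; congr (if _ then _ else _).
have yp : (y < p)%N by rewrite (leq_trans (ltn_ord y)) // Zp_cast.
apply/idP/eqP => [|->]; last exact: dvdn0.
case: (posnP y) => [y0 _|y0 /(dvdn_leq y0)]; first exact: val_inj.
by rewrite leqNgt yp.
Qed.

Lemma fourierE f xi : fourier f xi = p%:R^-1 * \sum_x f x * (chi (xi * x))^*%C.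
Proof.
rewrite /fourier; congr (_ * _); apply: eq_bigr => x _.
by rewrite expiN chiM /unity.
Qed.

Lemma fourier_inversion f x : f x = \sum_xi fourier f xi * chi (xi * x).
Proof.
transitivity (p%:R^-1 * \sum_y f y * \sum_xi chi (xi * (x - y))).
  under eq_bigr => y _ do rewrite sum_chi subr_eq0.
  rewrite (bigD1 x) //= eqxx big1 ?addr0 => [|y yx]; first by rewrite mulrC mulfK.
  by rewrite eq_sym (negbTE yx) mulr0.
rewrite mulr_sumr; under [RHS]eq_bigr => xi _ do rewrite fourierE -mulrA mulr_suml mulr_sumr.
rewrite exchange_big; apply: eq_bigr => y _; rewrite !mulr_sumr.
by apply: eq_bigr => xi _; rewrite mulrBr chiD chiN; ring.
Qed.

Lemma fourier_parseval f :
  \sum_xi normc (fourier f xi) ^+ 2 = p%:R^-1 * \sum_x normc (f x) ^+ 2.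
Proof.
have fourier_conj xi : (fourier f xi)^*%C = p%:R^-1 * \sum_x (f x)^*%C * chi (xi * x).
  rewrite fourierE rmorphM fmorphV rmorph_nat rmorph_sum; congr (_ * _).
  by apply: eq_bigr => x _; exact: conj_mul_conj.
apply: (@complexI R); rewrite rmorphM fmorphV rmorph_nat !rmorph_sum /=.
under eq_bigr => xi _ do rewrite -mulc_conj fourier_conj.
under [in RHS]eq_bigr => x _ do rewrite -mulc_conj {1}(fourier_inversion f x).
rewrite mulr_sumr; under [in RHS]eq_bigr => x _ do rewrite mulr_suml mulr_sumr.
rewrite [RHS]exchange_big; apply: eq_bigr => xi _.
by rewrite !mulr_sumr; apply: eq_bigr => x _; ring.
Qed.

Lemma normc_le_wiener f x : normc (f x) <= wiener_norm f.
Proof.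
rewrite (fourier_inversion f x); apply: le_trans (normc_sum _ _ _) _.
by apply: ler_sum => xi _; rewrite normcM normc_chi mulr1.
Qed.

Lemma max_modulus_le_wiener f : max_modulus f <= wiener_norm f.
Proof.
rewrite /max_modulus; elim/big_ind: _ => [|u v hu hv|x _].
- by apply: sumr_ge0 => xi _; exact: normc_ge0.
- by rewrite ge_max hu.
- exact: normc_le_wiener.
Qed.

Section RieszProduct.
Context (w : 'Z_p -> R[i]) (a b : R).

Definition riesz (s : seq 'Z_p) xi : R :=
  \prod_(x <- s) (a + b * complex.Re (w x * chi (xi * x))).

(** The frequencies of a Riesz product are signed sums of its generators. *)
Lemma riesz_spectrum s y : y \notin signed_sums s ->
  \sum_xi (riesz s xi)%:C * chi (xi * y) = 0.
Proof.
elim: s y => [|x s IH] y.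
  rewrite inE => y0; under eq_bigr => xi _ do rewrite /riesz big_nil mul1r.
  by rewrite sum_chi (negbTE y0).
rewrite mem_signed_sums_cons !negb_or => /and3P[y0 ym yp].
have -> : \sum_xi (riesz (x :: s) xi)%:C * chi (xi * y) =
   a%:C * (\sum_xi (riesz s xi)%:C * chi (xi * y)) +
   (b / 2)%:C * w x * (\sum_xi (riesz s xi)%:C * chi (xi * (y + x))) +
   (b / 2)%:C * (w x)^*%C * (\sum_xi (riesz s xi)%:C * chi (xi * (y - x))).
  rewrite !mulr_sumr -!big_split; apply: eq_bigr => xi _ /=.
  rewrite /riesz big_cons !mulrDr mulrN !chiD chiN.
  set v := \prod_(j <- s) _; move: (chi (xi * x)) (chi (xi * y)) (w x) => [c1 c2] [d1 d2] [w1 w2].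
  by apply/eqP; rewrite eq_complex /=; apply/andP; split; apply/eqP; field.
by rewrite !IH // !mulr0 !addr0.
Qed.

Lemma sum_riesz s : dissociated s -> \sum_xi riesz s xi = p%:R * a ^+ size s.
Proof.
elim: s => [_|x s IH /= /andP[xs ds]].
  under eq_bigr => xi _ do rewrite /riesz big_nil.
  by rewrite (sum_Zp (fun=> 1)) sumr_const card_ord mulr1.
have -> : \sum_xi riesz (x :: s) xi = a * (\sum_xi riesz s xi) +
    b * complex.Re (w x * (\sum_xi (riesz s xi)%:C * chi (xi * x))).
  rewrite !mulr_sumr Re_sum mulr_sumr -big_split; apply: eq_bigr => xi _ /=.
  rewrite /riesz big_cons.
  set v := \prod_(j <- s) _; move: (chi (xi * x)) (w x) => [c1 c2] [w1 w2] /=; ring.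
by rewrite riesz_spectrum // mulr0 mulr0 addr0 IH // exprS; ring.
Qed.

End RieszProduct.

(** Follows from [exp (- u) >= 1 - u] by taking inverses. *)
Lemma expR_quadratic (u : R) : u <= 1 / 2 -> expR u <= 1 + u + 2 * u ^+ 2.
Proof.
move=> u2; have := expR_ge1Dx (- u); rewrite expRN => le1.
have e0 := expR_gt0 u.
have e1 : (1 - u) * expR u <= 1 by rewrite -ler_pdivlMr // mul1r.
have u0 : 0 < 1 - u by lra.
rewrite -(ler_pM2l u0); apply: le_trans e1 _.
have u1 : 0 <= 1 - 2 * u by lra.
have := mulr_ge0 (sqr_ge0 u) u1; lra.
Qed.

(** The characters of a dissociated sequence behave like independent
    variables. The bound [exp u <= 1 + u + 2 u^2] replaces the exponential by a
    Riesz product, of which only the constant term survives. *)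
Lemma sum_expR_dissociated (w : 'Z_p -> R[i]) (t : R) s :
  (forall x, normc (w x) <= 1) -> `|t| <= 1 / 2 -> dissociated s ->
  \sum_xi expR (t * \sum_(x <- s) complex.Re (w x * chi (xi * x))) <=
  p%:R * expR (2 * t ^+ 2 * (size s)%:R).
Proof.
move=> w1 t2 ds.
apply: (@le_trans _ _ (\sum_xi riesz w (1 + 2 * t ^+ 2) t s xi)).
  apply: ler_sum => xi _; rewrite mulr_sumr expR_sum /riesz.
  apply: ler_prod => x _; rewrite expR_ge0 /=.
  set v := complex.Re _; have v1 : `|v| <= 1.
    by apply: le_trans (abs_Re_le _) _; rewrite normcM normc_chi mulr1.
  have tv : t * v <= 1 / 2.
    apply: le_trans (ler_norm _) _; rewrite normrM.
    by apply: le_trans t2; rewrite ler_piMr.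
  apply: le_trans (expR_quadratic tv) _; rewrite exprMn.
  have v2 : v ^+ 2 <= 1 by rewrite -(real_normK (num_real v)) expr_le1.
  by have := ler_wpM2l (sqr_ge0 t) v2; lra.
rewrite sum_riesz // ler_wpM2l ?ler0n // expRM_natr.
by rewrite lerXn2r ?nnegrE ?expR_ge0 ?expR_ge1Dx // addr_ge0 // mulr_ge0 // sqr_ge0.
Qed.

Section Dimension.
Context (f : 'Z_p -> R[i]) (S_neq0 : supp f != set0).
Context (f_ge1 : forall x, x \in supp f -> 1 <= normc (f x)).

Let K := wiener_norm f.
Let N : R := #|supp f|%:R.

Lemma supp_card_ge1 : 1 <= N.
Proof. by rewrite ler1n card_gt0. Qed.

Lemma wiener_ge1 : 1 <= K.
Proof.
have /set0Pn [x xS] := S_neq0.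
exact: le_trans (f_ge1 xS) (normc_le_wiener f x).
Qed.

Lemma fourier_L2_le : \sum_xi normc (fourier f xi) ^+ 2 <= N * K ^+ 2 / p%:R.
Proof.
rewrite fourier_parseval mulrC ler_wpM2r ?invr_ge0 ?ler0n //.
rewrite (bigID (fun x => x \in supp f)) /= [X in _ + X]big1 ?addr0; last first.
  by move=> x; rewrite inE negbK => /eqP ->; rewrite normc0 expr0n.
rewrite /N -sum1_card natr_sum mulr_suml; apply: ler_sum => x _.
rewrite mul1r ler_pXn2r ?nnegrE ?normc_ge0 ?normc_le_wiener //.
by rewrite (le_trans _ wiener_ge1).
Qed.

(** Jensen's inequality for the probability weights [|f^| / K], applied to
    [exp (t |Re W|)], whose mean is controlled by Cauchy-Schwarz and the
    exponential moments of [W]; Jensen is used through the tangent line of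
    the exponential at [y0]. *)
Lemma sum_fourier_dissociated (w : 'Z_p -> R[i]) (t : R) s :
  (forall x, normc (w x) <= 1) -> 0 <= t <= 1 / 4 -> dissociated s ->
  t * \sum_xi normc (fourier f xi) *
        `|\sum_(x <- s) complex.Re (w x * chi (xi * x))| <=
  K * (ln (2 * N) + 4 * t ^+ 2 * (size s)%:R).
Proof.
move=> w1 /andP[t0 t4] ds.
pose W xi := \sum_(x <- s) complex.Re (w x * chi (xi * x)).
pose F xi := normc (fourier f xi).
have F0 xi : 0 <= F xi by exact: normc_ge0.
have K1 := wiener_ge1; have N1 := supp_card_ge1.
have p0 : (0 : R) < p%:R by rewrite ltr0n.
pose E := expR (4 * t ^+ 2 * (size s)%:R).
have E0 : 0 < E by exact: expR_gt0.
have moment (sg : R) : `|sg| = 1 -> \sum_xi F xi * expR (sg * t * W xi) <= N * K * E.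
  (* Cauchy-Schwarz in the form of AM-GM, with the weight [l] that balances the
     bounds for the two sums up to a factor [N]. *)
  move=> sg1; pose l := p%:R * E / (N * K).
  have l0 : 0 < l by rewrite divr_gt0 ?mulr_gt0 //; lra.
  apply: (@le_trans _ _ (1 / 2 * l * (\sum_xi F xi ^+ 2) +
      1 / 2 / l * \sum_xi expR (2 * sg * t * W xi))).
    rewrite !mulr_sumr -big_split; apply: ler_sum => xi _ /=.
    rewrite (_ : 2 * sg * t * W xi = sg * t * W xi + sg * t * W xi); last by ring.
    rewrite expRD; move: (F xi) (expR _) => u v; rewrite -subr_ge0.
    have -> : 1 / 2 * l * u ^+ 2 + 1 / 2 / l * (v * v) - u * v = 1 / 2 / l * (l * u - v) ^+ 2.
      by field; rewrite gt_eqF.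
    by rewrite mulr_ge0 ?sqr_ge0 // divr_ge0 // ltW.
  have sg2 : sg ^+ 2 = 1 by rewrite -(real_normK (num_real sg)) sg1 expr1n.
  have t2 : `|2 * sg * t| <= 1 / 2 by rewrite !normrM sg1 !ger0_norm //; lra.
  have := sum_expR_dissociated w1 t2 ds.
  have -> : expR (2 * (2 * sg * t) ^+ 2 * (size s)%:R) = E ^+ 2.
    by rewrite /E -expRM_natl !exprMn sg2; congr expR; ring.
  move=> le2.
  apply: (@le_trans _ _ (1 / 2 * l * (N * K ^+ 2 / p%:R) + 1 / 2 / l * (p%:R * E ^+ 2))); last first.
    have -> : 1 / 2 * l * (N * K ^+ 2 / p%:R) + 1 / 2 / l * (p%:R * E ^+ 2) =
        (1 + N) / 2 * (K * E) by rewrite /l; field; rewrite !gt_eqF //; lra.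
    by rewrite -[N * K * E]mulrA ler_wpM2r ?mulr_ge0 //; lra.
  apply: lerD; rewrite ler_wpM2l ?fourier_L2_le //; first by rewrite mulr_ge0 // ltW.
  by rewrite divr_ge0 // ltW.
pose y0 := ln (2 * N) + 4 * t ^+ 2 * (size s)%:R.
have Ey0 : expR y0 = 2 * N * E by rewrite expRD lnK // posrE; lra.
have : \sum_xi F xi * (1 + (t * `|W xi| - y0)) <= K.
  apply: (@le_trans _ _ (\sum_xi (F xi * expR (1 * t * W xi) + F xi * expR (-1 * t * W xi)) / expR y0)).
    apply: ler_sum => xi _; rewrite -mulrDr -mulrA ler_wpM2l //.
    apply: le_trans (expR_ge1Dx _) _; rewrite expRB ler_wpM2r ?invr_ge0 ?expR_ge0 //.
    by case: (ger0P (W xi)) => _; rewrite ?mulrN -?mulNr !mul1r ?mulN1r ?lerDl ?lerDr expR_ge0.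
  rewrite -mulr_suml big_split /= ler_pdivrMr ?expR_gt0 // Ey0.
  have := moment 1 (normr1 _); have := moment (-1) (normrN1 _).
  lra.
have -> : \sum_xi F xi * (1 + (t * `|W xi| - y0)) = K - K * y0 + t * \sum_xi F xi * `|W xi|.
  rewrite /K /wiener_norm mulr_suml mulr_sumr -sumrB -big_split.
  by apply: eq_bigr => xi _ /=; rewrite -/(F xi); ring.
by rewrite -/y0 /F /W; lra.
Qed.

(** Testing [f^] against [W = \sum_(x in s) w_x chi_x], where [w_x] is the
    conjugate phase of [f x], gives at least [size s]. The previous lemma bounds
    it by [2 K (ln (2 N) / t + 4 t size s)], and [t = 1 / (16 K)] makes the
    last term half of [size s]. *)
Lemma dissociated_size_le s : {subset s <= supp f} -> dissociated s ->
  (size s)%:R <= 64 * K ^+ 2 * ln (2 * N).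
Proof.
move=> sS ds; pose w x := (f x)^*%C / (normc (f x))%:C.
have K1 := wiener_ge1; set d : R := (size s)%:R.
have w1 x : normc (w x) <= 1.
  rewrite normcM normcV normc_conj normc_real ger0_norm ?normc_ge0 //.
  by case: (eqVneq (normc (f x)) 0) => [->|h]; rewrite ?mul0r // divff.
(* The imaginary part of [W] is the real part for the coefficients [- i w_x]. *)
have iw1 x : normc (- 'i%C * w x) <= 1.
  by rewrite normcM normcN (_ : normc 'i%C = 1) ?mul1r //= expr0n expr1n add0r sqrtr1.
pose W (v : 'Z_p -> R[i]) xi := \sum_(x <- s) complex.Re (v x * chi (xi * x)).
pose F xi := normc (fourier f xi).
have test : d <= \sum_xi F xi * `|W w xi| + \sum_xi F xi * `|W (fun x => - 'i%C * w x) xi|.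
  apply: (@le_trans _ _ (complex.Re (\sum_(x <- s) f x * w x))).
    rewrite Re_sum /d -sum1_size natr_sum big_seq [X in _ <= X]big_seq.
    apply: ler_sum => x xs; have := f_ge1 (sS _ xs).
    rewrite /w mulrA mulc_conj -fmorphV -rmorphM /= expr2 => h.
    by rewrite mulfK // gt_eqF // (lt_le_trans _ h).
  under eq_bigr => x _ do rewrite (fourier_inversion f x) mulr_suml.
  rewrite exchange_big Re_sum -big_split; apply: ler_sum => xi _ /=.
  under eq_bigr => x _ do rewrite -mulrA [chi _ * _]mulrC.
  rewrite -mulr_sumr -mulrDr; apply: le_trans (Re_le _) _.
  rewrite normcM ler_wpM2l ?normc_ge0 //; apply: le_trans (normc_le_ReIm _) _.
  rewrite Re_sum lerD2l (_ : W _ xi = complex.Im (\sum_(x <- s) w x * chi (xi * x))) //.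
  rewrite /W -Re_sum; under eq_bigr => x _ do rewrite -mulrA.
  by rewrite -mulr_sumr; case: (\sum_(x <- s) _) => u v /=; ring.
pose t : R := (16 * K)^-1.
have t0 : 0 < t by rewrite invr_gt0 mulr_gt0 //; lra.
have tK : t * K = 1 / 16 by rewrite /t; field; rewrite gt_eqF //; lra.
have t4 : 0 <= t <= 1 / 4.
  by rewrite ltW //=; have := ler_wpM2l (ltW t0) K1; rewrite tK mulr1; lra.
have h1 := sum_fourier_dissociated w1 t4 ds.
have h2 := sum_fourier_dissociated iw1 t4 ds.
have := ler_wpM2l (ltW t0) test; rewrite mulrDr.
have : K * (ln (2 * N) + 4 * t ^+ 2 * d) = K * ln (2 * N) + t * d / 4.
  by have -> : t * d / 4 = 4 * (t * K) * t * d; [rewrite tK; field | ring].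
rewrite -/d in h1 h2; rewrite -/(W _ _) -/(F _) => e le1.
have : t * d <= 2 * (K * ln (2 * N) + t * d / 4) by rewrite -e; move: h1 h2 le1; rewrite /W /F; lra.
move=> le2; have le3 : t * d <= 4 * (K * ln (2 * N)) by lra.
have K16 : 0 <= 16 * K by lra.
have := ler_wpM2l K16 le3; have -> : 16 * K * (t * d) = 16 * (t * K) * d by ring.
rewrite tK; lra.
Qed.

End Dimension.

End FourierZp.

(** * Rectification of the support *)

Section Rectification.
Context {p : nat} (p_gt1 : (1 < p)%N).
Implicit Types (u v x t : 'Z_p) (r : nat) (s : seq 'Z_p).

(** [v] has a representative of absolute value at most [r]; shifting it by [r]
    keeps it a natural number. *)
Definition near r v := exists2 a : nat, (a <= 2 * r)%N & v = a%:R - r%:R.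

Lemma near0 : near 0 (0 : 'Z_p).
Proof. by exists 0%N; rewrite ?subrr. Qed.

Lemma nearN r v : near r v -> near r (- v).
Proof.
move=> [a ar ->]; exists (2 * r - a)%N; first exact: leq_subr.
by rewrite natrB // natrM; ring.
Qed.

Lemma nearD r r' u v : near r u -> near r' v -> near (r + r') (u + v).
Proof.
move=> [a ar ->] [b br ->]; exists (a + b)%N; first by rewrite mulnDr leq_add.
by rewrite !natrD; ring.
Qed.

Lemma near_signed_sums r t s : {in s, forall x, near r (t * x)} ->
  {in signed_sums s, forall y, near (size s * r) (t * y)}.
Proof.
elim: s => [_ y|x s IH near_s y].
  by rewrite inE => /eqP ->; rewrite mulr0; exact: near0.
have near_tx : near r (t * x) by apply: near_s; rewrite mem_head.
have {}IH := IH (fun z zs => near_s z (mem_behead (s := x :: s) zs)).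
rewrite mem_signed_sums_cons => /or3P[] /IH near_y /=; rewrite mulSn addnC.
- rewrite -[t * y]addr0; apply: nearD near_y _.
  by exists r; rewrite ?subrr // leq_pmull.
- by rewrite -[y](subrK x) mulrDr; exact: nearD.
- by rewrite -[y](addrK x) mulrBr; apply: nearD => //; exact: nearN.
Qed.

Lemma Zp_lt v : (v < p)%N.
Proof. by rewrite (leq_trans (ltn_ord v)) // Zp_cast. Qed.

Lemma near_same_box Q u v : (0 < Q)%N -> (u * Q %/ p = v * Q %/ p)%N ->
  near (p.-1 %/ Q) (u - v).
Proof.
move=> Q0; wlog vu : u v / (v <= u)%N.
  move=> wl e; case: (leqP v u) => [|/ltnW] le; first exact: wl.
  by rewrite -opprB; apply: nearN; exact: wl.
move=> e; exists (u - v + p.-1 %/ Q)%N; last by rewrite natrD natrB // !natr_Zp addrK.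
have p0 : (0 < p)%N by exact: ltnW.
suff : (u - v <= p.-1 %/ Q)%N by lia.
rewrite leq_divRL // mulnBl.
have := divn_eq (u * Q) p; have := divn_eq (v * Q) p; rewrite e.
have := ltn_pmod (u * Q) p0; have := ltn_pmod (v * Q) p0.
have : (v * Q <= u * Q)%N by rewrite leq_mul2r vu orbT.
lia.
Qed.

(** Dirichlet's simultaneous approximation theorem, by the pigeonhole
    principle in the cube divided into [Q ^ size s] boxes. *)
Lemma dirichlet_approximation Q s : (0 < Q)%N -> (Q ^ size s < p)%N ->
  exists2 t, t != 0 & {in s, forall x, near (p.-1 %/ Q) (t * x)}.
Proof.
move=> Q0 Qp; have p0 : (0 < p)%N by exact: ltnW.
have box_lt v : (v * Q %/ p < Q)%N by rewrite ltn_divLR // mulnC ltn_pmul2l // Zp_lt.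
pose box t := [ffun i : 'I_(size s) => Ordinal (box_lt (t * s`_i))].
have /injectivePn [t [t' tt' e]] : ~~ injectiveb box.
  apply/negP => /injectiveP /leq_card; rewrite card_ffun !card_ord leqNgt.
  by rewrite [X in (_ < X)%N]Zp_cast ?Qp.
exists (t - t'); first by rewrite subr_eq0.
move=> x /(nthP 0) [i is_ <-]; rewrite mulrBl; apply: near_same_box => //.
have /(congr1 val) := congr1 (fun g : {ffun _} => g (Ordinal is_)) e.
by rewrite !ffunE /=.
Qed.

End Rectification.

Section Rectified.
Context {R : realType} {p : nat} (p_prime : prime p).
Context (f : 'Z_p -> R[i]) (S_neq0 : supp f != set0).
Context (f_ge1 : forall x, x \in supp f -> 1 <= normc (f x)).
Implicit Types (x xi t : 'Z_p).

Let p_gt1 : (1 < p)%N := prime_gt1 p_prime.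

Lemma Zp_unit t : t != 0 -> t \is a GRing.unit.
Proof.
move=> t0; rewrite -[t]natr_Zp unitZpE // prime_coprime // gtnNdvd ?Zp_lt //.
by rewrite lt0n.
Qed.

(** Dilations and translations of [f] do not change its Wiener norm. *)
Lemma wiener_dilation t r (a : 'Z_p -> nat) : t != 0 ->
  (forall x, x \in supp f -> t * x = (a x)%:R - r%:R) ->
  wiener_norm f =
  avg p (fun z => normc (\sum_(x in supp f) f x * z ^+ a x)).
Proof.
move=> t0 ta.
have inj : injective (fun xi => - (t * xi)).
  by move=> u v /oppr_inj /(mulrI (Zp_unit t0)).
rewrite /wiener_norm (reindex_inj inj) /avg mulr_sumr.
rewrite -(sum_Zp p_gt1 (fun k => p%:R^-1 * normc (\sum_(x in supp f) f x * unity p k ^+ a x))).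
apply: eq_bigr => xi _.
rewrite fourierE // normcM normcV normc_nat; congr (_ * _).
have -> : \sum_x f x * (chi (- (t * xi) * x))^*%C =
    chi (- (xi * r%:R)) * \sum_(x in supp f) f x * unity p xi ^+ a x.
  under eq_bigr => x _ do rewrite -chiN // -mulNr opprK -mulrA mulrCA.
  rewrite (bigID (fun x => x \in supp f)) /= [X in _ + X]big1 ?addr0 => [|x].
    rewrite mulr_sumr; apply: eq_bigr => x xS.
    by rewrite ta // mulrBr chiD // [xi * (a x)%:R]mulr_natr chiMn // mulrA mulrC.
  by rewrite inE negbK => /eqP ->; rewrite mul0r.
by rewrite normcM normc_chi mul1r.
Qed.

Lemma ln4_le2 : ln 4 <= 2 :> R.
Proof.
have : ln (1 + 1) <= 1 :> R by apply: le_ln1Dx; lra.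
have -> : 4 = (1 + 1) ^+ 2 :> R by ring.
by rewrite lnXn //; lra.
Qed.

(** The largest number [m] of full blocks satisfies [m >= 1] and
    [N <= 4 ^ (m + 1)]. *)
Lemma ln_le_block N : (0 < N)%N -> exists2 m, (block_start m <= N)%N &
  ln N%:R <= 4 * m%:R :> R.
Proof.
move=> N0; have leid m : (m <= block_start m)%N.
  elim: m => // m IH; rewrite block_startS -addn1 leq_add // expn_gt0 //.
have ltpow m : (block_start m < 4 ^ m)%N.
  elim: m => [|m IH]; first by rewrite /block_start big_ord0.
  by rewrite block_startS expnS; lia.
have ex0 : exists m, (block_start m <= N)%N by exists 0%N; rewrite /block_start big_ord0.
have bd m : (block_start m <= N)%N -> (m <= N)%N by apply: leq_trans.
have [m mN mmax] := ex_maxnP ex0 bd.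
exists m => //; have m1 : (1 <= m)%N.
  by apply: mmax; rewrite /block_start big_ord_recl big_ord0.
have lt4 : (N <= 4 ^ m.+1)%N.
  apply: leq_trans (ltnW (ltpow _)); rewrite leqNgt; apply/negP => /ltnW /mmax.
  by rewrite ltnn.
have ln4 := ln4_le2.
apply: (@le_trans _ _ (ln (4 ^+ m.+1))).
  by rewrite ler_ln ?posrE ?ltr0n // ?exprn_gt0 // -natrX ler_nat.
rewrite lnXn // -[ln 4 *+ _]mulr_natl -[m.+1%:R]natr1.
have : 1 <= m%:R :> R by rewrite ler1n.
nra.
Qed.

(** A short basis of the support lets a dilation move it into an interval of
    length less than [p / 2], where the Wiener norm is comparable with an
    integral over the circle and Littlewood's inequality applies. The constant
    is [168 = 4 * 28 * (3 / 2)]. *)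
Lemma wiener_ge_rectified s :
  {subset supp f <= signed_sums s} -> (0 < size s)%N ->
  ((4 * size s) ^ size s < p)%N ->
  ln #|supp f|%:R <= 168 * wiener_norm f.
Proof.
set d := size s => Ss d0 dp.
have Q0 : (0 < 4 * d)%N by rewrite muln_gt0.
have [t t0 near_s] := dirichlet_approximation p_gt1 Q0 dp.
set r := (p.-1 %/ (4 * d))%N in near_s.
have near_S := near_signed_sums near_s.
have /choice [a aP] : forall x, exists a : nat, x \in supp f ->
    (a <= 2 * (d * r))%N /\ t * x = a%:R - (d * r)%:R.
  move=> x; case: (boolP (x \in supp f)) => [/Ss /near_S [a]|_]; last by exists 0%N.
  by exists a.
have a_inj : {in supp f &, injective a}.
  move=> x y xS yS e; apply: (mulrI (Zp_unit t0)).
  by rewrite (aP x xS).2 (aP y yS).2 e.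
rewrite (wiener_dilation t0 (fun x xS => (aP x xS).2)).
pose M := (2 * (d * r))%N.
have Mp : (2 * M < p)%N.
  have : (r * (4 * d) <= p.-1)%N by exact: leq_trunc_div.
  by rewrite /M; lia.
set N := #|supp f|; have N0 : (0 < N)%N by rewrite card_gt0.
(* Littlewood's inequality is stated for decreasing exponents. *)
pose l := sort (fun x y => a y <= a x)%N (enum (supp f)).
have l_size : size l = N by rewrite size_sort -cardE.
have mem_l x : (x \in l) = (x \in supp f) by rewrite mem_sort mem_enum.
have l_uniq : uniq l by rewrite sort_uniq enum_uniq.
pose x_ k := nth 0 l k.
have xS k : (k < N)%N -> x_ k \in supp f by move=> kN; rewrite -mem_l mem_nth // l_size.
pose n k := a (x_ k); pose c k := f (x_ k).
have n_decr i j : (i < j < N)%N -> (n j < n i)%N.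
  case/andP=> ij jN; have iN := ltn_trans ij jN.
  rewrite ltn_neqAle; apply/andP; split.
    apply/eqP => /(a_inj _ _ (xS _ jN) (xS _ iN)) /eqP.
    by rewrite nth_uniq ?l_size // gtn_eqF.
  have tr : transitive (fun x y : 'Z_p => a y <= a x)%N by move=> y x z /[swap]; exact: leq_trans.
  have l_sorted : sorted (fun x y : 'Z_p => a y <= a x)%N l.
    by apply: sort_sorted => x y; exact: leq_total.
  by apply: (sorted_ltn_nth tr 0 l_sorted) => //; rewrite inE l_size.
have c_ge1 k : (k < N)%N -> 1 <= normc (c k) by move=> kN; exact: f_ge1 (xS _ kN).
have [m mN lnN] := ln_le_block N0.
have [P0 lit] := littlewood_large n_decr c_ge1 mN.
pose P := maxn P0 (2 * M).+1.
have {}lit := lit P (leq_maxl _ _).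
have sz : (size (sparse_poly N n c) <= M.+1)%N.
  apply: (leq_trans (size_sum _ _ _)); apply/bigmax_leqP => k _.
  apply: leq_trans (size_scale_leq _ _) _; rewrite size_polyXn ltnS.
  exact: (aP _ (xS _ (ltn_ord k))).1.
have MP : (2 * M < P)%N by exact: leq_maxr.
have := avg_transfer sz Mp MP.
have -> : avg p (fun z => normc (sparse_poly N n c).[z]) =
    avg p (fun z => normc (\sum_(x in supp f) f x * z ^+ a x)).
  apply: eq_avg => z; congr normc; rewrite horner_sum.
  under eq_bigr => k _ do rewrite hornerZ hornerXn.
  rewrite -(big_mkord xpredT (fun k => c k * z ^+ n k)) -l_size.
  rewrite -(big_nth 0 xpredT (fun x => f x * z ^+ a x)) /=.
  by rewrite (perm_big (enum (supp f))) ?big_enum // perm_sort.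
lra.
Qed.

End Rectified.

(** * Conclusion *)

Section Sizes.
Context {R : realType}.

(** [e <= (6 / 5) ^ 6]. The inequality makes [ln (ln p)] positive for
    [p >= 3], with a lower bound independent of [p]. *)
Lemma expR1_lt3 : expR 1 < 3 :> R.
Proof.
have e6 : expR (1 / 6) <= 6 / 5 :> R.
  have := expR_ge1Dx (- (1 / 6) : R); rewrite expRN => le1.
  have e0 := expR_gt0 (1 / 6 : R).
  have : (5 / 6) * expR (1 / 6) <= 1 :> R by rewrite -ler_pdivlMr // [X in _ <= X]mul1r; lra.
  lra.
have -> : 1 = 6%:R * (1 / 6) :> R by field.
rewrite expRM_natl; apply: (@le_lt_trans _ _ ((6 / 5) ^+ 6)); last lra.
by rewrite lerXn2r // nnegrE ?expR_ge0.
Qed.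

Lemma lnln3_gt0 : 0 < ln (ln 3) :> R.
Proof.
rewrite ln_gt0 // -[X in X < _]expRK ltr_ln ?posrE ?expR_gt0 //.
exact: expR1_lt3.
Qed.

Definition dimension_const : R := 1 + 2 / ln (ln 3).

Lemma dimension_const_ge1 : 1 <= dimension_const.
Proof. by rewrite lerDl divr_ge0 // ltW // lnln3_gt0. Qed.

Lemma lnln_ge p : (3 <= p)%N -> ln (ln 3) <= ln (ln p%:R) :> R /\ 0 < ln p%:R :> R.
Proof.
move=> p3; have p3R : 3 <= p%:R :> R by rewrite ler_nat.
have l3 : 1 < ln 3 :> R.
  by rewrite -[X in X < _]expRK ltr_ln ?posrE ?expR_gt0 // expR1_lt3.
have lp : ln 3 <= ln p%:R :> R by rewrite ler_ln ?posrE //; lra.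
by split; rewrite ?ler_ln ?posrE //; lra.
Qed.

(** The hypothesis gives [ln p <= d ln (4 d)]. One may assume [d < ln p], and
    then [ln (4 d) <= 2 + ln (ln p)]. *)
Lemma dimension_ge p d : (3 <= p)%N -> (0 < d)%N -> (p <= (4 * d) ^ d)%N ->
  ln p%:R / ln (ln p%:R) <= dimension_const * d%:R :> R.
Proof.
move=> p3 d0 pd; have [ll lp] := lnln_ge p3.
have l0 := lnln3_gt0; have d1 : 1 <= d%:R :> R by rewrite ler1n.
set l := ln (ln p%:R) in ll *; set l3 := ln (ln 3) in l0 ll.
have lpos : 0 < l by exact: lt_le_trans ll.
rewrite ler_pdivrMr //; case: (leP (ln p%:R) (d%:R : R)) => [le|lt].
  apply: le_trans le _; rewrite mulrAC ler_peMl ?ler0n //.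
  rewrite /dimension_const -/l3 mulrDl mul1r.
  have : 2 / l3 * l3 <= 2 / l3 * l by rewrite ler_wpM2l // divr_ge0 // ltW.
  by rewrite divfK ?gt_eqF //; lra.
have le1 : ln p%:R <= d%:R * (ln 4 + ln d%:R) :> R.
  have -> : d%:R * (ln 4 + ln d%:R) = ln (((4 * d) ^ d)%:R) :> R.
    by rewrite natrX natrM lnXn ?lnM ?posrE ?mulr_gt0 ?ltr0n // mulr_natl.
  rewrite ler_ln ?posrE ?ltr0n ?ler_nat //; first by lia.
  by rewrite expn_gt0 muln_gt0 d0.
have ld : ln d%:R <= l by rewrite ler_ln ?posrE ?ltr0n // ltW.
have ln4 := @ln4_le2 R.
apply: le_trans le1 _; rewrite [dimension_const * _]mulrC -mulrA ler_wpM2l ?ler0n //.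
rewrite /dimension_const -/l3 mulrDl mul1r [l + _]addrC; apply: lerD => //.
apply: le_trans ln4 _; have : 2 / l3 * l3 <= 2 / l3 * l by rewrite ler_wpM2l // divr_ge0 // ltW.
by rewrite divfK ?gt_eqF.
Qed.

End Sizes.

(** The alternative depends on whether a maximal dissociated subset of the
    support, of size at most [64 K^2 ln (2 N)], is small enough for Dirichlet's
    theorem to apply. *)
Lemma wiener_dichotomy (R : realType) (p : nat) (p_ge3 : (3 <= p)%N) (p_prime : prime p)
    (f : 'Z_p -> R[i]) (f_ge1 : forall x, x \in supp f -> 1 <= normc (f x)) :
  (2 <= #|supp f|)%N ->
  ln #|supp f|%:R <= 168 * dimension_const * wiener_norm f \/
  (ln p%:R / (ln (ln p%:R) * ln #|supp f|%:R)) `^ (1 / 2) <=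
    168 * dimension_const * wiener_norm f.
Proof.
move=> N2; have p_gt1 := prime_gt1 p_prime.
have S_neq0 : supp f != set0 by rewrite -card_gt0; lia.
have K1 := wiener_ge1 p_gt1 S_neq0 f_ge1.
have C1 := @dimension_const_ge1 R.
set K := wiener_norm f in K1 *; set C := dimension_const in C1 *; set N := #|supp f| in N2 *.
have K0 : 0 <= K by lra.
have CK : 0 <= C * K by rewrite mulr_ge0 //; lra.
have [s [sS ds Ss]] := dissociated_basis (enum (supp f)).
have {}sS : {subset s <= supp f} by move=> x /sS; rewrite mem_enum.
have {}Ss : {subset supp f <= signed_sums s} by move=> x xS; apply: Ss; rewrite mem_enum.
have d0 : (0 < size s)%N.
  rewrite lt0n; apply/eqP => /size0nil s0; rewrite s0 in Ss.
  have /subset_leq_card : supp f \subset [set 0].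
    by apply/subsetP => x /Ss; rewrite !inE.
  by rewrite cards1 leqNgt N2.
case: (ltnP ((4 * size s) ^ size s) p) => [dp|pd]; [left|right].
  apply: le_trans (wiener_ge_rectified p_prime S_neq0 f_ge1 Ss d0 dp) _.
  rewrite -mulrA ler_wpM2l // -/K ler_peMl //; lra.
have dle := dissociated_size_le p_gt1 S_neq0 f_ge1 sS ds.
have Xle := @dimension_ge R _ _ p_ge3 d0 pd.
rewrite -/K -/N in dle; rewrite -/C in Xle.
have [ll lp] := @lnln_ge R p p_ge3; have l0 := lt_le_trans (@lnln3_gt0 R) ll.
set l := ln (ln p%:R) in ll l0 Xle *.
have N2R : 2 <= N%:R :> R by rewrite ler_nat.
have lnN : 0 < ln N%:R :> R by rewrite ln_gt0; lra.
have ln2N : ln (2 * N%:R) <= 2 * ln N%:R :> R.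
  have -> : 2 * ln N%:R = ln (N%:R * N%:R) :> R by rewrite lnM ?posrE; lra.
  by rewrite ler_ln ?posrE ?mulr_gt0 ?ler_wpM2r //; lra.
rewrite mul1r powR12_sqrt; last by rewrite divr_ge0 ?mulr_ge0 // ltW.
rewrite -[_ * K]ger0_norm; last by rewrite -mulrA mulr_ge0.
rewrite -sqrtr_sqr ler_wsqrtr // invfM mulrA ler_pdivrMr //.
apply: le_trans Xle _.
have h1 : C * (size s)%:R <= C * (64 * K ^+ 2 * (2 * ln N%:R)).
  rewrite ler_wpM2l //; first lra.
  by apply: le_trans dle _; rewrite ler_wpM2l // mulr_ge0 // sqr_ge0.
apply: le_trans h1 _.
have -> : C * (64 * K ^+ 2 * (2 * ln N%:R)) = 128 * C * (K ^+ 2 * ln N%:R) by ring.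
have -> : (168 * C * K) ^+ 2 * ln N%:R = 168 ^+ 2 * C ^+ 2 * (K ^+ 2 * ln N%:R) by ring.
rewrite ler_wpM2r ?mulr_ge0 ?sqr_ge0 ?(ltW lnN) //.
have CC : 0 <= C * (C - 1) by rewrite mulr_ge0 //; lra.
lra.
Qed.

Theorem theorem1 (R : realType) :
  exists c : R, 0 < c /\
    forall (p : nat) (p_ge3 : (3 <= p)%N) (p_prime : prime p)
           (f : 'Z_p -> R[i])
           (S_neq0 : supp f != set0)
           (f_ge1 : forall x, x \in supp f -> 1 <= normc (f x)),
      [/\ max_modulus f <= wiener_norm f,
          (c%:E * Order.min (ln (#|supp f|%:R : R))%:E
                            (sparse_bound R p #|supp f|)
             <= (wiener_norm f)%:E)%E
        & #|supp f|%:R <= expR ((ln p%:R / ln (ln p%:R)) `^ (1 / 3)) :> R ->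
          c * ln #|supp f|%:R <= wiener_norm f].
Proof.
have C1 := @dimension_const_ge1 R.
have B0 : 0 < 168 * dimension_const :> R by rewrite mulr_gt0 //; lra.
exists (168 * dimension_const)^-1; split; first by rewrite invr_gt0.
move=> p p_ge3 p_prime f S_neq0 f_ge1; have p_gt1 := prime_gt1 p_prime.
have K1 := wiener_ge1 p_gt1 S_neq0 f_ge1.
have K0 : 0 <= wiener_norm f by lra.
have N0 : (0 < #|supp f|)%N by rewrite card_gt0.
have scale (u : R) : u <= 168 * dimension_const * wiener_norm f ->
    (168 * dimension_const)^-1 * u <= wiener_norm f.
  by move=> h; rewrite mulrC ler_pdivrMr // mulrC.
have [N1|N1] := eqVneq #|supp f| 1%N.
  rewrite N1 ln1 mulr0 /sparse_bound eqxx; split => //; first exact: max_modulus_le_wiener.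
  by rewrite minEle leey mule0 lee_fin.
have N2 : (2 <= #|supp f|)%N by lia.
have dich := wiener_dichotomy p_ge3 p_prime f_ge1 N2.
split; first exact: max_modulus_le_wiener.
  rewrite /sparse_bound (negbTE N1) -EFin_min -EFinM lee_fin; apply: scale.
  by rewrite ge_min; case: dich => ->; rewrite ?orbT.
move=> Nle; apply: scale; case: dich => // le2; apply: le_trans le2.
have [ll lp] := @lnln_ge R p p_ge3; have l0 := lt_le_trans (@lnln3_gt0 R) ll.
have N2R : 2 <= #|supp f|%:R :> R by rewrite ler_nat.
set L := ln #|supp f|%:R; have L0 : 0 < L by rewrite ln_gt0; lra.
set X := ln p%:R / ln (ln p%:R) in Nle.
have X0 : 0 <= X by rewrite divr_ge0 // ltW.
have LX : L <= X `^ (1 / 3) by rewrite -[leRHS]expRK ler_ln ?posrE ?expR_gt0 //; lra.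
have L3 : L ^+ 3 <= X.
  have -> : X = (X `^ (1 / 3)) ^+ 3.
    by rewrite -powR_mulrn ?powR_ge0 // -powRrM mul1r mulVf // powRr1.
  by rewrite lerXn2r ?nnegrE ?powR_ge0 ?(ltW L0).
have XL0 : 0 <= X / L by rewrite divr_ge0 // ltW.
rewrite invfM mulrA -/X mul1r powR12_sqrt //.
rewrite -[L in leLHS](ger0_norm (ltW L0)) -sqrtr_sqr ler_wsqrtr //.
by rewrite ler_pdivlMr // -exprSr.
Qed.
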